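(* Let $\Omega\subset\mathbb R^2$ be a bounded rational convex polygon. For every $N\ge1$ and every strongly generic configuration $P=\{p_1,\dots,p_N\}\subset\Omega^\circ$, the number $g(\Gamma_P)$ of bounded complementary cells of $\Gamma_P$ satisfies $$g(\Gamma_P)=N .$$ Moreover, writing $R_1,\dots,R_N$ for the bounded complementary cells and $a_i\in\mathbb F_2^N$ for the vector whose $j$-th coordinate is $1$ if $p_i\in\overline{R_j}$ and $0$ otherwise, the $N$ bounded-face incidence vectors $a_1,\dots,a_N$ form a basis of $\mathbb F_2^N$.
   Context: A bounded rational convex polygon is a compact convex polygon $\Omega\subset\mathbb R^2$ with nonempty interior $\Omega^\circ$, of the form $\Omega=\bigcap_{r=1}^s\{x:\langle n_r,x\rangle+a_r\ge0\}$ with primitive $n_r\in\mathbb Z^2$, $a_r\in\mathbb R$. An $\Omega$-tropical series is a continuous function $F:\Omega\to\mathbb R_{\ge0}$ with $F=0$ on $\partial\Omega$ which near every point of $\Omega^\circ$ has the form $F(x)=\min_{m\in A}(c_m+\langle m,x\rangle)$ with $A\subset\mathbb Z^2$ finite and $c_m\in\mathbb R$; it is concave. Its corner locus $V(F)\subset\Omega^\circ$ is the set of points where the minimum is attained by at least two distinct affine functions. For nonempty finite $P\subset\Omega^\circ$, the tropical relaxation $F_P=G_P0_\Omega$ is the pointwise infimum of all $\Omega$-tropical series $G$ with $P\subset V(G)$; it is itself such a series. Put $\Gamma_P=V(F_P)$. A bounded complementary cell of $\Gamma_P$ is a connected component of $\Omega^\circ\setminus\Gamma_P$ whose closure is contained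 in $\Omega^\circ$ (does not meet $\partial\Omega$). The linearity cells of $F_P$ are the closures of the maximal connected open subsets of $\Omega^\circ$ on which $F_P$ is affine; each has a gradient in $\mathbb Z^2$. $\Gamma_P$ is a finite embedded polyhedral graph, whose vertices are the points $v\in\Omega^\circ$ whose superdifferential $\{p:F_P(y)\le F_P(v)+\langle p,y-v\rangle\ \forall y\in\Omega\}$ is two-dimensional and whose edges are the straight segments into which the vertices divide it; an edge separating cells of gradients $m_0,m_1$ has weight $w\ge1$ where $m_1-m_0=wn$ with $n\in\mathbb Z^2$ primitive. The gradient-labelled marked type of $P=(p_1,\dots,p_N)$ consists of the embedded face poset of this subdivision of $\Omega$ (cells, edges, vertices, incidences, cyclic orders), the gradient of each two-dimensional cell, all edge weights, all incidences with the sides and vertices of $\Omega$, and for each $i$ the face containing $p_i$ in its relative interior. $P$ (a set of $N$ distinct points of $\Omega^\circ$) is strongly generic if (i) every $p_i$ lies in the relative interior of an edge of $\Gamma_P$; (ii) distinct $p_i$ lie on distinct edges; (iii) the gradient-labelled marked type is unchanged under all sufficiently small independent perturbations of the points $p_i$. *)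

(* Defs.v *)
From HB Require Import structures.
From mathcomp Require Import all_boot all_order all_algebra.
From mathcomp Require Import all_classical all_reals all_analysis.
Set Implicit Arguments.
Unset Strict Implicit.
Unset Printing Implicit Defensive.
Import Order.TTheory GRing.Theory Num.Theory.
Import numFieldNormedType.Exports.
Local Open Scope classical_set_scope.
Local Open Scope ring_scope.

(* Functions on Omega are represented by total functions 'rV[R]_2 -> R of which
   only the values on Omega matter. *)

Section plane.
Variable R : realType.
Implicit Types (u v x y z : 'rV[R]_2) (S : set 'rV[R]_2).

Definition dot u v : R := \sum_i u 0 i * v 0 i.

Definition lat (m : 'rV[int]_2) : 'rV[R]_2 := map_mx intr m.

Definition primitive (n : 'rV[int]_2) : Prop := coprimez (n 0 0) (n 0 1).

Definition det2 u v : R := u 0 0 * v 0 1 - u 0 1 * v 0 0.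

Definition affine_hull S : set 'rV[R]_2 :=
  [set x | exists k (t : 'I_k -> R) (y : 'I_k -> 'rV[R]_2),
     [/\ \sum_i t i = 1, (forall i, S (y i)) & x = \sum_i t i *: y i]].

Definition relint S : set 'rV[R]_2 :=
  [set x | S x /\ \forall y \near x, affine_hull S y -> S y].

Definition unit_vec u : 'rV[R]_2 := (Num.sqrt (dot u u))^-1 *: u.

(* For x1, x2, x3 distinct from z: seen from z, the points x1, x2, x3 lie in
   distinct directions, met in this cyclic order when turning counterclockwise: three distinct points of the
   unit circle are in counterclockwise order iff the triangle that they span
   is positively oriented. *)
Definition ccw z x1 x2 x3 : Prop :=
  let d x := unit_vec (x - z) in 0 < det2 (d x2 - d x1) (d x3 - d x1).

Definition rational_polygon (Omega : set 'rV[R]_2) : Prop :=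
  [/\ compact Omega, Omega° !=set0 &
      exists s (n : 'I_s -> 'rV[int]_2) (a : 'I_s -> R),
        (forall r, primitive (n r)) /\
        Omega = [set x | forall r, 0 <= dot (lat (n r)) x + a r]].

(* The sides and the vertices of Omega: its nonempty intersections with
   supporting lines. *)
Definition polygon_face (Omega S : set 'rV[R]_2) : Prop :=
  S !=set0 /\
  exists (n : 'rV[R]_2) (a : R),
    [/\ n != 0, (forall x, Omega x -> 0 <= dot n x + a) &
        S = Omega `&` [set x | dot n x + a = 0]].

End plane.

Section tropical_series.
Variable R : realType.
Implicit Types (Omega C e P : set 'rV[R]_2) (F G : 'rV[R]_2 -> R).
Implicit Types (x y v p : 'rV[R]_2).

Definition aff (c : 'rV[int]_2 -> R) (m : 'rV[int]_2) x : R :=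
  c m + dot (lat R m) x.

(* F y is the minimum of the values c_m + <m, y>, m in A; this forces A to be
   nonempty. *)
Definition is_min_at F (A : seq 'rV[int]_2) (c : 'rV[int]_2 -> R) y : Prop :=
  (exists2 m, m \in A & F y = aff c m y) /\
  (forall m, m \in A -> F y <= aff c m y).

Definition tropical_form F x A c : Prop := \forall y \near x, is_min_at F A c y.

Definition tropical_series Omega F : Prop :=
  [/\ {within Omega, continuous F},
      (forall x, Omega x -> 0 <= F x),
      (forall x, (Omega `\` Omega°) x -> F x = 0) &
      (forall x, Omega° x -> exists A c, tropical_form F x A c)].

Definition corner_locus Omega F : set 'rV[R]_2 :=
  [set x | Omega° x /\
     exists A c, tropical_form F x A c /\
       exists m1 m2, [/\ m1 \in A, m2 \in A, m1 != m2,
                         F x = aff c m1 x & F x = aff c m2 x]].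

Definition relaxation Omega P : 'rV[R]_2 -> R :=
  fun x => inf [set G x | G in
    [set G | tropical_series Omega G /\ P `<=` corner_locus Omega G]].

Definition bounded_cell Omega (Gamma : set 'rV[R]_2) : set (set 'rV[R]_2) :=
  [set C | (exists2 x, (Omega° `\` Gamma) x &
              C = connected_component (Omega° `\` Gamma) x) /\
           closure C `<=` Omega°].

Definition affine_on F (U : set 'rV[R]_2) : Prop :=
  exists (c : R) p, forall x, U x -> F x = c + dot p x.

Definition linear_region Omega F (U : set 'rV[R]_2) : Prop :=
  [/\ open U, connected U, U `<=` Omega° & affine_on F U].

Definition cell Omega F : set (set 'rV[R]_2) :=
  [set C | exists U,
     [/\ linear_region Omega F U,
         (forall U', linear_region Omega F U' -> U `<=` U' -> U' = U) &
         C = closure U]].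

Definition superdiff Omega F v : set 'rV[R]_2 :=
  [set p | forall y, Omega y -> F y <= F v + dot p (y - v)].

(* The superdifferential is convex, and a convex subset of the plane is
   two-dimensional iff it contains three affinely independent points. *)
Definition vertex Omega F : set 'rV[R]_2 :=
  [set v | Omega° v /\
     exists p0 p1 p2,
       [/\ superdiff Omega F v p0, superdiff Omega F v p1,
           superdiff Omega F v p2 & det2 (p1 - p0) (p2 - p0) != 0]].

(* An edge is taken with its endpoints; an endpoint may lie on the boundary of
   Omega. *)
Definition edge Omega F : set (set 'rV[R]_2) :=
  let E := corner_locus Omega F `\` vertex Omega F in
  [set e | exists2 x, E x & e = closure (connected_component E x)].

Definition vertex_face Omega F : set (set 'rV[R]_2) :=
  [set [set v] | v in vertex Omega F].

(* The closed faces of the subdivision of Omega, including the sides and the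
   vertices of Omega itself. *)
Definition face Omega F : set (set 'rV[R]_2) :=
  cell Omega F `|` edge Omega F `|` vertex_face Omega F `|` polygon_face Omega.

Definition has_gradient F C (m : 'rV[int]_2) : Prop :=
  exists c : R, forall x, C x -> F x = c + dot (lat R m) x.

Definition has_weight Omega F e (w : nat) : Prop :=
  (0 < w)%N /\
  exists C0 C1 m0 m1 n,
    [/\ cell Omega F C0, cell Omega F C1, C0 <> C1 & e `<=` C0 `&` C1] /\
    [/\ has_gradient F C0 m0, has_gradient F C1 m1, primitive n &
        m1 - m0 = n *+ w].

Definition incident (S T : set 'rV[R]_2) : Prop := S `<=` T \/ T `<=` S.

(* The faces S1, S2, S3 follow each other counterclockwise around the face T:
   around T = [set v] these are the faces at v, around a cell T the faces of its
   boundary, and around an edge T its endpoints and the cells on either side. *)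
Definition ccw_around (T S1 S2 S3 : set 'rV[R]_2) : Prop :=
  exists z x1 x2 x3,
    [/\ relint T z, relint S1 x1, relint S2 x2 & relint S3 x3] /\
    ccw z x1 x2 x3.

(* F with the marked points p and F' with the marked points p' have the same
   gradient-labelled marked type: there is a bijection phi between the faces
   preserving all the data. *)
Definition same_marked_type Omega N F (p : 'I_N -> 'rV[R]_2)
    F' (p' : 'I_N -> 'rV[R]_2) : Prop :=
  exists phi : set 'rV[R]_2 -> set 'rV[R]_2,
  [/\ set_bij (face Omega F) (face Omega F') phi,
      (forall S T, face Omega F S -> face Omega F T ->
         (S `<=` T <-> phi S `<=` phi T)),
      (forall S, face Omega F S ->
         [/\ cell Omega F S <-> cell Omega F' (phi S),
             edge Omega F S <-> edge Omega F' (phi S) &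
             vertex_face Omega F S <-> vertex_face Omega F' (phi S)]) &
      (forall T S1 S2 S3,
         face Omega F T -> face Omega F S1 -> face Omega F S2 ->
         face Omega F S3 ->
         incident S1 T -> incident S2 T -> incident S3 T ->
         T <> S1 -> T <> S2 -> T <> S3 -> S1 <> S2 -> S1 <> S3 -> S2 <> S3 ->
         (ccw_around T S1 S2 S3 <->
          ccw_around (phi T) (phi S1) (phi S2) (phi S3)))] /\
  [/\ (forall C m, cell Omega F C ->
         (has_gradient F C m <-> has_gradient F' (phi C) m)),
      (forall e w, edge Omega F e ->
         (has_weight Omega F e w <-> has_weight Omega F' (phi e) w)),
      (forall S, polygon_face Omega S -> phi S = S),
      (forall S T, polygon_face Omega S -> face Omega F T ->
         (T `&` relint S !=set0 <-> phi T `&` relint S !=set0)) &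
      (forall i S, face Omega F S ->
         (relint S (p i) <-> relint (phi S) (p' i)))].

Definition strongly_generic Omega N (p : 'I_N -> 'rV[R]_2) : Prop :=
  let F q := relaxation Omega (range q) in
  [/\ injective p /\ (forall i, Omega° (p i)),
      (forall i, exists2 e, edge Omega (F p) e & relint e (p i)),
      (forall i j e, edge Omega (F p) e ->
         relint e (p i) -> relint e (p j) -> i = j) &
      exists2 eps : R, 0 < eps &
        forall q : 'I_N -> 'rV[R]_2, (forall i, ball (p i) eps (q i)) ->
          same_marked_type Omega (F p) p (F q) q].

Definition incidence_vector N (p : 'I_N -> 'rV[R]_2)
    (C : 'I_N -> set 'rV[R]_2) (i : 'I_N) : 'rV['F_2]_N :=
  \row_j (p i \in closure (C j))%:R.

End tropical_series.

(* Main.v *)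
(* On Omega the relaxation F is the minimum of finitely many integral affine
   functions c_m + <m, x>: competitors for F may be replaced by smaller ones
   lying below k times the distances to the sides, and this bounds their
   gradients. After discarding redundant functions the components of the
   complement of Gamma are the open regions where a single m is active, and a
   point p_i inside an edge is adjacent to exactly two of them, m0 i and m1 i.

   Let M have a row for every p_i and a column for every bounded region m, with
   entry [m = m0 i] - [m = m1 i].
   - Left kernel of M: the coefficient of a region that meets the boundary of
     Omega is determined by m, since F vanishes there. As the marked type is
     stable, moving p_i to q_i changes the coefficients of the bounded regions
     by some d with (M d)_i = <m1 i - m0 i, q_i - p_i>, and these right-hand
     sides can be prescribed freely.
   - Right kernel of M: if M d = 0, the functions with coefficients c + s d are
     competitors for all s near 0 of either sign; by minimality of F, d = 0.
   Hence M is square and invertible over R. It is the incidence matrix of a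
   directed graph with one vertex removed, so its determinant is 1 or -1, and M
   stays invertible modulo 2, where its rows are the incidence vectors. *)
Require Import Defs.
From HB Require Import structures.
From mathcomp Require Import all_boot all_order all_algebra.
From mathcomp Require Import all_classical all_reals all_analysis.
From mathcomp Require Import ring lra.
Set Implicit Arguments.
Unset Strict Implicit.
Unset Printing Implicit Defensive.
Import Order.TTheory GRing.Theory Num.Theory.
Import numFieldNormedType.Exports.
Local Open Scope classical_set_scope.
Local Open Scope card_scope.
Local Open Scope ring_scope.

(** * Affine functions on the plane, their germs and their finite minima *)

Section affine_geometry.
Variable R : realType.
Implicit Types (p u v w x y z : 'rV[R]_2) (m : 'rV[int]_2) (S : set 'rV[R]_2).

Lemma row2P u v : u 0 0 = v 0 0 -> u 0 1 = v 0 1 -> u = v.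
Proof.
move=> e0 e1; apply/rowP => -[[|[|//]] i2].
  by have -> : Ordinal i2 = 0 by exact: val_inj.
by have -> : Ordinal i2 = 1 by exact: val_inj.
Qed.

Lemma dotE u v : dot u v = u 0 0 * v 0 0 + u 0 1 * v 0 1.
Proof.
rewrite /dot !big_ord_recl big_ord0 addr0.
by rewrite (_ : lift ord0 ord0 = 1) //; exact: val_inj.
Qed.

Lemma dotDl u v w : dot (u + v) w = dot u w + dot v w.
Proof. by rewrite !dotE !mxE; ring. Qed.

Lemma dotBl u v w : dot (u - v) w = dot u w - dot v w.
Proof. by rewrite !dotE !mxE; ring. Qed.

Lemma dotZl k u w : dot (k *: u) w = k * dot u w.
Proof. by rewrite !dotE !mxE; ring. Qed.

Lemma dot0l w : dot 0 w = 0.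
Proof. by rewrite !dotE !mxE; ring. Qed.

Lemma dotDr u v w : dot u (v + w) = dot u v + dot u w.
Proof. by rewrite !dotE !mxE; ring. Qed.

Lemma dotBr u v w : dot u (v - w) = dot u v - dot u w.
Proof. by rewrite !dotE !mxE; ring. Qed.

Lemma dotZr k u v : dot u (k *: v) = k * dot u v.
Proof. by rewrite !dotE !mxE; ring. Qed.

Lemma dotNr u v : dot u (- v) = - dot u v.
Proof. by rewrite !dotE !mxE; ring. Qed.

Lemma dotNl u v : dot (- u) v = - dot u v.
Proof. by rewrite !dotE !mxE; ring. Qed.

Definition dotR := (dotDl, dotDr, dotNl, dotNr, dotZl, dotZr).

Lemma dot_ge0 u : 0 <= dot u u.
Proof. by rewrite dotE addr_ge0 // -expr2 sqr_ge0. Qed.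

Lemma dot_eq0 u : (dot u u == 0) = (u == 0).
Proof.
apply/eqP/eqP => [|->]; last exact: dot0l.
rewrite dotE => /eqP; rewrite paddr_eq0 -?expr2 ?sqr_ge0 //.
by rewrite !sqrf_eq0 => /andP[/eqP u0 /eqP u1]; apply: row2P; rewrite mxE.
Qed.

Lemma dot_gt0 u : u != 0 -> 0 < dot u u.
Proof. by move=> u0; rewrite lt_def dot_eq0 u0 dot_ge0. Qed.

Lemma lat_inj : injective (@lat R).
Proof.
move=> m m' /rowP mm'; apply/rowP => i; move: (mm' i); rewrite !mxE.
exact: intr_inj.
Qed.

Lemma lat_eq0 m : (lat R m == 0) = (m == 0).
Proof.
by rewrite -(inj_eq lat_inj); congr (_ == _); apply/rowP => i; rewrite !mxE.
Qed.

Lemma dot_lat0 x : dot (lat R 0) x = 0.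
Proof. by rewrite dotE !mxE !mul0r addr0. Qed.

Lemma dot_latMn m k x : dot (lat R (m *+ k)) x = k%:R * dot (lat R m) x.
Proof. by rewrite -dotZl scaler_nat /lat raddfMn. Qed.

Lemma dot_continuous u : continuous (dot u).
Proof.
rewrite (_ : dot u = fun x => u 0 0 * x 0 0 + u 0 1 * x 0 1); last first.
  by apply/funext => x; rewrite dotE.
move=> x; have c j : (fun y : 'rV[R]_2 => u 0 j * y 0 j) @ x --> u 0 j * x 0 j.
  exact: (cvgM (cvg_cst _) (@coord_continuous R _ _ 0 j x)).
exact: (cvgD (c 0) (c 1)).
Qed.

Lemma near_dot_gt0 u (a : R) x : 0 < dot u x + a ->
  \forall y \near x, 0 < dot u y + a.
Proof.
have c : (fun y => dot u y + a) @ x --> dot u x + a.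
  exact: (cvgD (@dot_continuous u x) (cvg_cst _)).
move=> ux_gt0; exact: (c _ (open_nbhs_nbhs (conj (@open_gt R 0) ux_gt0))).
Qed.

Lemma aff_continuous c m : continuous (@aff R c m).
Proof. by move=> x; exact: (cvgD (cvg_cst _) (@dot_continuous (lat R m) x)). Qed.

Lemma nbhs_line x v S : nbhs x S -> \forall t \near (0 : R), S (x + t *: v).
Proof.
have lc : {for 0, continuous (fun t : R => x + t *: v)}.
  exact: (cvgD (cvg_cst _) (@scalel_continuous _ _ _ _)).
by move=> xS; apply: lc; rewrite scale0r addr0.
Qed.

Lemma near0_pm (Q : R -> Prop) :
  (\forall t \near (0 : R), Q t) -> exists2 t : R, 0 < t & Q t /\ Q (- t).
Proof.
move=> /nbhs_ballP[e /= e0 eQ]; exists (e / 2); first lra.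
by split; apply: eQ; rewrite /ball /= sub0r ?opprK ?normrN gtr0_norm; lra.
Qed.

(** A step [t] from [x] in the direction [p1 - p2] raises the difference of the two functions from 0
    to [t] times the squared length of [p1 - p2], which the inequality forces to be at most 0. *)
Lemma affine_touch x (c1 c2 : R) p1 p2 :
  (\forall y \near x, c1 + dot p1 y <= c2 + dot p2 y) ->
  c1 + dot p1 x = c2 + dot p2 x -> p1 = p2.
Proof.
move=> /(nbhs_line (p1 - p2))/near0_pm[t t0 [le _]] eq.
apply/eqP; rewrite -subr_eq0 -dot_eq0 eq_le dot_ge0 andbT.
have : t * dot (p1 - p2) (p1 - p2) <= 0 by move: le; rewrite !dotR => le; lra.
by rewrite pmulr_rle0.
Qed.

Lemma aff_touch x c1 c2 m1 m2 :
  (\forall y \near x, aff (R := R) c1 m1 y <= aff c2 m2 y) ->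
  aff c1 m1 x = aff c2 m2 x -> m1 = m2.
Proof. by move=> le eq; apply: lat_inj; apply: affine_touch le eq. Qed.

Lemma seq_argmin (T : eqType) (f : T -> R) (A : seq T) : A != [::] ->
  exists2 i, i \in A & forall j, j \in A -> f i <= f j.
Proof.
elim: A => // i [|i1 A] IH _.
  by exists i; rewrite ?mem_head // => j; rewrite inE => /eqP ->.
have [//|i2 i2A i2min] := IH.
have [le|lt] := leP (f i) (f i2).
  exists i; rewrite ?mem_head // => j; rewrite inE => /predU1P[->//|/i2min].
  exact: le_trans.
exists i2; first by rewrite inE i2A orbT.
by move=> j; rewrite inE => /predU1P[->|/i2min//]; exact: ltW.
Qed.

Lemma near_seq (T : eqType) (I : choiceType) (A : seq I) (F : set_system T)
    (Q : I -> T -> Prop) : Filter F ->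
  (forall i, i \in A -> \forall x \near F, Q i x) ->
  \forall x \near F, forall i, i \in A -> Q i x.
Proof.
move=> FF; elim: A => [|i A IH] AQ; first by near=> x.
have IH' : \forall x \near F, forall i, i \in A -> Q i x.
  by apply: IH => j jA; apply: AQ; rewrite inE jA orbT.
have Qi := AQ i (mem_head _ _).
near=> x => j; rewrite inE => /predU1P[->|]; first by near: x.
by move: j; near: x.
Unshelve. all: by end_near. Qed.

(** The initial value of the iterated minimum is the value of the first function, so it does not
    disturb the minimum over a nonempty list. *)
Definition minf (A : seq 'rV[int]_2) (c : 'rV[int]_2 -> R) x : R :=
  \big[Order.min/aff c (head 0 A) x]_(m <- A) aff c m x.

Lemma minf_continuous A c : continuous (minf A c).
Proof.
rewrite /minf; elim: A {1}(head 0 A) => [|m A IH] m0 x.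
  rewrite (_ : (fun _ => _) = aff c m0); first exact: aff_continuous.
  by apply/funext => y; rewrite big_nil.
rewrite (_ : (fun _ => _) = fun y => Order.min (aff c m y)
   (\big[Order.min/aff c m0 y]_(m <- A) aff c m y)); last first.
  by apply/funext => y; rewrite big_cons.
by apply: continuous_min; [exact: aff_continuous|exact: IH].
Qed.

Lemma minfP A c x : A != [::] -> is_min_at (minf A c) A c x.
Proof.
move=> A0; have [m mA mmin] := seq_argmin (fun m => aff c m x) A0.
have le m' : m' \in A -> minf A c x <= aff c m' x.
  by move=> m'A; apply: ge_bigmin_seq.
split=> //; exists m => //; apply/eqP; rewrite eq_le le //= /minf.
have hA : head 0 A \in A by case: (A) A0 => // *; rewrite mem_head.
by rewrite big_seq; apply: le_bigmin => [|i iA]; exact: mmin.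
Qed.

Lemma is_min_at_eq (F G : 'rV[R]_2 -> R) A c x :
  is_min_at F A c x -> is_min_at G A c x -> F x = G x.
Proof.
move=> [[m mA Fm] Fle] [[m' m'A Gm] Gle]; apply/eqP; rewrite eq_le.
by rewrite {1}Gm {2}Fm Fle // Gle.
Qed.

Lemma is_min_at_minf (F : 'rV[R]_2 -> R) A c x : is_min_at F A c x -> F x = minf A c x.
Proof.
by move=> Fx; apply: is_min_at_eq (Fx) (minfP c x _); case: Fx => -[]; case: A.
Qed.

Lemma tropical_form_continuous (F : 'rV[R]_2 -> R) A c x :
  tropical_form F x A c -> {for x, continuous F}.
Proof.
move=> Fx; have e : \forall y \near x, minf A c y = F y.
  by near=> y; apply/esym/is_min_at_minf; near: y.
have cF : minf A c @ x --> F x.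
  rewrite -(nbhs_singleton e); exact: minf_continuous.
exact: cvg_trans (near_eq_cvg e) cF.
Unshelve. all: by end_near. Qed.

Definition conv_set S := forall x y (t : R), S x -> S y -> 0 <= t <= 1 ->
  S (x + t *: (y - x)).

Lemma conv_set_connected S : conv_set S -> connected S.
Proof.
move=> cS; have [[x Sx]|] := pselect (S !=set0); last first.
  by move=> S0 B [y By] [C oC CB] _; exfalso; apply: S0; exists y; move: By; rewrite CB => -[].
rewrite (_ : S = \bigcup_(y in S) [set x + t *: (y - x) | t in `[0, 1]]).
  apply: bigcup_connected.
    exists x => y Sy; exists 0; rewrite ?scale0r ?addr0 //=.
    by rewrite in_itv /= lexx ler01.
  move=> y Sy; apply: connected_continuous_connected; first exact: segment_connected.
  apply: continuous_subspaceT => t.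
  exact: (cvgD (cvg_cst _) (@scalel_continuous _ _ _ _)).
apply/seteqP; split=> [y Sy|_ [y Sy [t t01 <-]]].
  exists y => //; exists 1; rewrite ?scale1r 1?addrC ?subrK //=.
  by rewrite in_itv /= lexx ler01.
exact: cS.
Qed.

End affine_geometry.

(** * Convexity of the polygon, its faces, and concavity of tropical series *)

Section polygon.
Variable R : realType.
Implicit Types (p v x y z : 'rV[R]_2) (m : 'rV[int]_2) (Omega S : set 'rV[R]_2).

(** A step from an interior point against [n r] strictly lowers the [r]-th constraint, because a
    primitive vector is nonzero. Conversely, finitely many strict inequalities persist nearby. *)
Lemma polygon_interior Omega s (n : 'I_s -> 'rV[int]_2) (a : 'I_s -> R) x :
  (forall r, primitive (n r)) ->
  Omega = [set x | forall r, 0 <= dot (lat R (n r)) x + a r] ->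
  Omega° x <-> forall r, 0 < dot (lat R (n r)) x + a r.
Proof.
move=> n_prim ->; split=> [xO r|x_gt0].
  have n0 : lat R (n r) != 0.
    rewrite lat_eq0; apply: contraPneq (n_prim r) => ->.
    by rewrite /primitive !mxE.
  have [t t0 [_ /= /(_ r)]] := near0_pm (nbhs_line (lat R (n r)) xO).
  by rewrite !dotR; have := dot_gt0 n0; nra.
apply: (@filter_forall _ _ (fun r y => 0 <= dot (lat R (n r)) y + a r) (nbhs x)) => r.
have h := near_dot_gt0 (x_gt0 r).
by near=> y; apply: ltW; near: y.
Unshelve. all: by end_near. Qed.

Lemma polygon_ray Omega x y (t : R) : rational_polygon Omega ->
  Omega° x -> Omega y -> 0 < t <= 1 -> Omega° (y + t *: (x - y)).
Proof.
move=> [_ _ [s [n [a [np Oe]]]]] /(polygon_interior _ np Oe) x_gt0 yO /andP[t0 t1].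
apply/(polygon_interior _ np Oe) => r; move: yO (x_gt0 r); rewrite Oe /= => /(_ r) y0 x0.
rewrite dotDr dotZr dotBr; nra.
Qed.

Lemma polygon_closed Omega : rational_polygon Omega -> closed Omega.
Proof. by move=> [cO _ _]; apply: compact_closed cO; exact: norm_hausdorff. Qed.

Lemma polygon_face_boundary Omega S x : polygon_face Omega S -> S x ->
  (Omega `\` Omega°) x.
Proof.
move=> [_ [n [a [n0 n_ge0 ->]]]] [xO /= nx]; split=> // xO'.
have [t t0 [_ /n_ge0]] := near0_pm (nbhs_line n xO').
by rewrite dotDr dotZr; have := dot_gt0 n0; nra.
Qed.

Lemma affine_hull_dot S p (c : R) x : (forall y, S y -> dot p y + c = 0) ->
  affine_hull S x -> dot p x + c = 0.
Proof.
move=> S0 [k [t [y [t1 Sy ->]]]].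
have -> : dot p (\sum_i t i *: y i) = \sum_i t i * dot p (y i).
  elim/big_rec2: _ => [|i b1 b2 _ <-]; last by rewrite dotDr dotZr.
  by rewrite dotE !mxE; ring.
rewrite -[c]mul1r -t1 mulr_suml -big_split big1 //= => i _.
by rewrite -mulrDr (S0 _ (Sy i)) mulr0.
Qed.

(** The sum of the constraints that vanish at [x] is a supporting function: it vanishes at a point
    of [Omega] exactly when each of them does. Near [x] the other constraints stay positive, and the
    vanishing ones are 0 on the affine hull of the face, so [x] is in its relative interior. *)
Lemma boundary_polygon_face Omega x : rational_polygon Omega ->
  (Omega `\` Omega°) x -> exists2 S, polygon_face Omega S & relint S x.
Proof.
move=> [_ [z zO] [s [n [a [np Oe]]]]] [xO xnO].
pose l r y := dot (lat R (n r)) y + a r.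
have l_ge0 r y : Omega y -> 0 <= l r y by rewrite Oe; apply.
have [r0 lr0] : exists r, l r x = 0.
  apply: contrapT => lx0; apply: xnO; apply/(polygon_interior _ np Oe) => r.
  rewrite lt_def l_ge0 // andbT; apply/eqP => lrx; apply: lx0; exists r; exact: lrx.
pose act r := l r x == 0.
pose N := \sum_(r | act r) lat R (n r); pose b := \sum_(r | act r) a r.
have NE y : dot N y + b = \sum_(r | act r) l r y.
  rewrite /N /b big_split; congr (_ + _).
  by elim/big_rec2: _ => [|r c1 c2 _ <-]; rewrite ?dotDl ?dot0l.
pose S := Omega `&` [set y | dot N y + b = 0].
have Sl y : S y -> forall r, act r -> l r y = 0.
  move=> [yO /=]; rewrite NE => /eqP; rewrite psumr_eq0 => [/allP /= al r|r _]; last exact: l_ge0.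
  by have := al r (mem_index_enum r) => /implyP lr /lr /eqP.
have Sx : S x by split=> //=; rewrite NE big1 // => r /eqP.
exists S; first split; first by exists x.
  exists N, b; split=> // [|y yO]; last by rewrite NE sumr_ge0 // => r _; exact: l_ge0.
  apply/eqP => N0; have [_ /=] := Sx; rewrite N0 dot0l add0r => b0.
  have := NE z; rewrite N0 dot0l b0 addr0 => /esym/eqP; rewrite psumr_eq0; last first.
    by move=> r _; apply: l_ge0; exact: interior_subset zO.
  move=> /allP/(_ r0 (mem_index_enum r0))/implyP/(_ _)/eqP; rewrite /act lr0 eqxx => /(_ isT).
  move/(polygon_interior _ np Oe): zO => /(_ r0); rewrite /l; lra.
split=> //.
have near_gt0 : \forall y \near x, forall r, ~~ act r -> 0 < l r y.
  apply: (@filter_forall _ _ (fun r y => ~~ act r -> 0 < l r y) (nbhs x)) => r.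
  have [lr|nlr] := boolP (act r); first exact: nearW.
  have lx : 0 < l r x by rewrite lt_def nlr l_ge0.
  have := near_dot_gt0 lx.
  exact: filterS.
near=> y => yS.
have ly r : act r -> l r y = 0.
  by move=> ar; apply: affine_hull_dot yS => w /Sl; apply.
split; last by rewrite /= NE big1.
rewrite Oe /= => r; have [ar|nar] := boolP (act r).
  by have := ly r ar; rewrite /l => ->.
by apply: ltW; move: r nar; near: y.
Unshelve. all: by end_near. Qed.

(* Tilting by the strictly concave [e u (1 - u)] rules out an interior minimum
   of the difference between [f] and its chord. *)
Lemma local_supergradient_chord (f : R -> R) :
  (forall t : R, 0 <= t <= 1 -> {for t, continuous f}) ->
  (forall t : R, 0 < t < 1 ->
     exists s : R, \forall u \near t, f u <= f t + s * (u - t)) ->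
  forall u : R, 0 <= u <= 1 -> (1 - u) * f 0 + u * f 1 <= f u.
Proof.
move=> fc fs u u01; rewrite leNgt; apply/negP => fu.
pose g t := f t - ((1 - t) * f 0 + t * f 1).
pose e := - g u.
have e0 : 0 < e by rewrite /e /g; lra.
pose k t := g t + e * (t * (1 - t)).
have kc : {within `[0, 1], continuous k}.
  apply: continuous_in_subspaceT => t; rewrite inE /= in_itv /= => t01.
  have tc : (fun t : R => t) @ t --> t by [].
  have tc' : (fun t : R => 1 - t) @ t --> 1 - t by exact: (cvgB (cvg_cst _) tc).
  apply: cvgD.
    by apply: (cvgB (fc _ t01)); apply: cvgD; apply: cvgM => //; exact: cvg_cst.
  by apply: (cvgM (cvg_cst _)); exact: cvgM.
have [t t01 tmin] := EVT_min (@ler01 R) kc.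
have kt : k t < 0.
  apply: (le_lt_trans (tmin u _)); first by rewrite in_itv.
  have gu : g u = - e by rewrite opprK.
  have u1 : u * (1 - u) < 1 by move: u01 => /andP[]; nra.
  rewrite /k gu; nra.
move: t01; rewrite in_itv /= => /andP[t0 t1].
have t0' : 0 < t.
  rewrite lt_def t0 andbT; apply/eqP => tE; move: kt; rewrite tE /k /g; lra.
have t1' : t < 1.
  rewrite lt_def t1 andbT; apply/eqP => tE; move: kt; rewrite -tE /k /g; lra.
have [|s /nbhs_ballP[d /= d0 fd]] := fs t; first by rewrite t0' t1'.
have [h [h0 hd ht0 ht1]] : exists h : R, [/\ 0 < h, h < d, h <= t & h <= 1 - t].
  exists (Order.min (d / 2) (Order.min t (1 - t))); split.
  - by rewrite !lt_min; apply/and3P; split; lra.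
  - by rewrite gt_min; apply/orP; left; lra.
  - by rewrite !ge_min lexx orbT.
  - by rewrite !ge_min lexx !orbT.
have bp : ball t d (t + h) by rewrite /ball /= opprD addrA subrr sub0r normrN gtr0_norm.
have bm : ball t d (t - h) by rewrite /ball /= opprB addrCA subrr addr0 gtr0_norm.
have := tmin (t + h); have := tmin (t - h); rewrite !in_itv /=.
have -> : 0 <= t - h <= 1 by apply/andP; split; lra.
have -> : 0 <= t + h <= 1 by apply/andP; split; lra.
move=> /(_ isT) km /(_ isT) kp.
have := fd _ bp; have := fd _ bm => /= fm fp.
have : 0 < e * h ^+ 2 by rewrite mulr_gt0 // exprn_gt0.
move: km kp; rewrite /k /g; nra.
Qed.

Lemma nbhs_segment x y (t : R) S : nbhs (x + t *: (y - x)) S ->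
  \forall u \near t, S (x + u *: (y - x)).
Proof.
have c : {for t, continuous (fun u : R => x + u *: (y - x))}.
  exact: (cvgD (cvg_cst _) (@scalel_continuous _ _ _ _)).
exact: c.
Qed.

(** Concavity of [G], obtained segment by segment: for interior [y], the difference [f] between [G]
    and the affine function lies above its chord, is 0 at [x] and at most 0 shortly after, hence at
    most 0 at [y]. On the boundary [G] is 0; a negative value of the affine function there would
    persist at an interior point, where [G] is nonnegative. *)
Lemma supergradient_global Omega (G : 'rV[R]_2 -> R) x (c0 : R) p :
  rational_polygon Omega -> tropical_series Omega G -> Omega° x ->
  (\forall y \near x, G y <= c0 + dot p y) -> G x = c0 + dot p x ->
  forall y, Omega y -> G y <= c0 + dot p y.
Proof.
move=> OP [_ G_ge0 G_bd G_form] xO Gle Gx.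
have int y : Omega° y -> G y <= c0 + dot p y.
  move=> yO; pose w (u : R) := x + u *: (y - x).
  have wO (u : R) : 0 <= u <= 1 -> Omega° (w u).
    move=> /andP[u0 u1]; have [->|u_neq0] := eqVneq u 0; first by rewrite /w scale0r addr0.
    apply: polygon_ray => //; last by rewrite lt_def u_neq0 u0.
    exact: interior_subset.
  pose f u := G (w u) - (c0 + dot p (w u)).
  have ws u t : w u = w t + (u - t) *: (y - x).
    by rewrite /w -addrA -scalerDl addrCA subrr addr0.
  have chord : forall u : R, 0 <= u <= 1 -> (1 - u) * f 0 + u * f 1 <= f u.
    apply: local_supergradient_chord => [t t01|t /andP[t0 t1]].
      have [A [c /tropical_form_continuous Gc]] := G_form _ (wO _ t01).
      have wc : {for t, continuous w}.
        exact: (cvgD (cvg_cst _) (@scalel_continuous _ _ _ _)).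
      have dc := continuous_comp wc (@dot_continuous _ p (w t)).
      exact: (cvgB (continuous_comp wc Gc) (cvgD (cvg_cst _) dc)).
    have t01 : 0 <= t <= 1 by rewrite !ltW.
    have [A [c Gf]] := G_form _ (wO _ t01).
    have [[m mA Gm] _] := nbhs_singleton Gf.
    exists (dot (lat R m - p) (y - x)).
    have : \forall u \near t, G (w u) <= aff c m (w u).
      apply: (@nbhs_segment x y t [set z | G z <= aff c m z]).
      by apply: filterS Gf => z [_]; apply.
    apply: filterS => u; rewrite /f Gm (ws u t) /aff !dotR => Gu.
    lra.
  have f0 : f 0 = 0 by rewrite /f /w scale0r addr0 Gx subrr.
  have [t t0 [[ft t1] _]] : exists2 t : R, 0 < t &
      (f t <= 0 /\ t < 1) /\ (f (- t) <= 0 /\ - t < 1).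
    apply: near0_pm; apply: filterI.
      have := nbhs_line (y - x) Gle; apply: filterS => t.
      by rewrite /f subr_le0.
    exact: (open_nbhs_nbhs (conj (@open_lt R 1) (@ltr01 R))).
  have := chord t; rewrite f0 (ltW t0) (ltW t1) => /(_ isT) ct.
  have : f 1 <= 0 by nra.
  by rewrite /f /w scale1r (addrC x) subrK subr_le0.
move=> y yO; have [/int//|yB] := pselect (Omega° y).
rewrite G_bd // leNgt; apply/negP => ly.
have lx : 0 <= c0 + dot p x by rewrite -Gx G_ge0 //; exact: interior_subset.
pose lx' := c0 + dot p x; pose ly' := c0 + dot p y.
(* With this [t] the affine function takes the value [ly' / 2] at [y + t *: (x - y)], still
   negative. *)
pose t := - ly' / (2 * (lx' - ly')).
have d0 : 0 < 2 * (lx' - ly') by rewrite /lx' /ly'; lra.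
have t01 : 0 < t <= 1.
  apply/andP; split; first by rewrite divr_gt0 // oppr_gt0.
  by rewrite ler_pdivrMr // /lx' /ly'; lra.
have zO := polygon_ray OP xO yO t01.
have := int _ zO; have := G_ge0 _ (interior_subset zO).
have : t * (2 * (lx' - ly')) = - ly' by rewrite divfK // gt_eqF.
rewrite !dotR /lx' /ly'; lra.
Qed.

End polygon.

(** * Minima of competitors, and a bound on gradients *)

Section relaxation.
Variable R : realType.
Implicit Types (x y : 'rV[R]_2) (m : 'rV[int]_2) (Omega P : set 'rV[R]_2).
Implicit Types (F G H : 'rV[R]_2 -> R) (A B : seq 'rV[int]_2) (c : 'rV[int]_2 -> R).

Definition competitor Omega P : set ('rV[R]_2 -> R) :=
  [set G | tropical_series Omega G /\ P `<=` corner_locus Omega G].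

(** Every function of a local presentation that is active at [x] touches [F] from above there, so
    its gradient is [m]; two distinct active gradients are impossible. *)
Lemma corner_locus_nonaffine Omega F x (c0 : R) m :
  (\forall y \near x, F y = c0 + dot (lat R m) y) -> ~ corner_locus Omega F x.
Proof.
move=> Fm [_ [A [c [Fx [m1 [m2 [m1A m2A /eqP m12 F1 F2]]]]]]].
have F0 := nbhs_singleton Fm; apply: m12.
have touch m' : m' \in A -> F x = aff c m' x -> m = m'.
  move=> m'A Fm'; apply: (@aff_touch _ x (fun=> c0) c); last by rewrite /aff -F0.
  by apply: filterS2 Fm Fx => y Fy [_ Fle]; rewrite /aff -Fy; exact: Fle.
by rewrite -(touch m1 m1A F1) -(touch m2 m2A F2).
Qed.

(** A presentation carries one constant per gradient, so for the minimum of two presentations a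
    gradient common to both lists receives the smaller constant. *)
Definition min_coef A1 c1 A2 c2 m : R :=
  if m \in A1 then if m \in A2 then Order.min (c1 m) (c2 m) else c1 m else c2 m.

Lemma min_coef_le1 A1 c1 A2 c2 m x : m \in A1 ->
  aff (min_coef A1 c1 A2 c2) m x <= aff c1 m x.
Proof.
by move=> mA1; rewrite lerD2r /min_coef mA1; case: ifP => //; rewrite ge_min lexx.
Qed.

Lemma min_coef_le2 A1 c1 A2 c2 m x : m \in A2 ->
  aff (min_coef A1 c1 A2 c2) m x <= aff c2 m x.
Proof.
move=> mA2; rewrite lerD2r /min_coef mA2; case: ifP => // _.
by rewrite ge_min lexx orbT.
Qed.

Lemma min_coef_ge A1 c1 A2 c2 F1 F2 m x :
  is_min_at F1 A1 c1 x -> is_min_at F2 A2 c2 x -> m \in A1 ++ A2 ->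
  Order.min (F1 x) (F2 x) <= aff (min_coef A1 c1 A2 c2) m x.
Proof.
move=> [_ F1m] [_ F2m]; rewrite mem_cat ge_min /aff /min_coef.
have [mA1|nmA1] := boolP (m \in A1); have [mA2|nmA2] := boolP (m \in A2) => // _.
- have [le|/ltW le] := leP (c1 m) (c2 m); apply/orP.
    by left; exact: F1m.
  by right; exact: F2m.
- by rewrite [X in X || _]F1m.
- by rewrite [X in _ || X]F2m ?orbT.
Qed.

Lemma is_min_at_min A1 c1 A2 c2 F1 F2 x :
  is_min_at F1 A1 c1 x -> is_min_at F2 A2 c2 x ->
  is_min_at (F1 \min F2)%O (A1 ++ A2) (min_coef A1 c1 A2 c2) x.
Proof.
move=> F1x F2x; split=> [|m mA]; last exact: min_coef_ge.
have [[[m1 m1A F1m] _] [[m2 m2A F2m] _]] := (F1x, F2x).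
have m1A' : m1 \in A1 ++ A2 by rewrite mem_cat m1A.
have m2A' : m2 \in A1 ++ A2 by rewrite mem_cat m2A orbT.
have ge m := @min_coef_ge A1 c1 A2 c2 F1 F2 m x F1x F2x.
move: ge; rewrite /=; have [_|_] := leP (F1 x) (F2 x) => ge.
  by exists m1 => //; apply/eqP; rewrite eq_le ge //= F1m min_coef_le1.
by exists m2 => //; apply/eqP; rewrite eq_le ge //= F2m min_coef_le2.
Qed.

Lemma tropical_form_min A1 c1 A2 c2 F1 F2 x :
  tropical_form F1 x A1 c1 -> tropical_form F2 x A2 c2 ->
  tropical_form (F1 \min F2)%O x (A1 ++ A2) (min_coef A1 c1 A2 c2).
Proof. by apply: filterS2 => y; exact: is_min_at_min. Qed.

Lemma corner_locus_min Omega F1 F2 x A2 c2 :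
  corner_locus Omega F1 x -> tropical_form F2 x A2 c2 -> F1 x <= F2 x ->
  corner_locus Omega (F1 \min F2)%O x.
Proof.
move=> [xO [A1 [c1 [F1x [m1 [m2 [m1A m2A m12 F1m F2m]]]]]]] F2x le.
split=> //; exists (A1 ++ A2), (min_coef A1 c1 A2 c2).
split; first exact: tropical_form_min.
have eqm m : m \in A1 -> F1 x = aff c1 m x ->
    (F1 \min F2)%O x = aff (min_coef A1 c1 A2 c2) m x.
  move=> mA F1xm; apply/eqP; rewrite /= eq_le.
  rewrite (min_coef_ge (nbhs_singleton F1x) (nbhs_singleton F2x)) ?mem_cat ?mA //=.
  by rewrite min_l // F1xm min_coef_le1.
by exists m1, m2; rewrite !mem_cat m1A m2A; split=> //; exact: eqm.
Qed.

Lemma min_funC F G : (F \min G)%O = (G \min F)%O.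
Proof. by apply/funext => x; rewrite /= minC. Qed.

(** The boundary values survive because [G] is 0 there and [H] is nonnegative. At a marked point a
    function attaining the minimum has a corner, and lowering the other functions to the minimum
    cannot deactivate its two active ones. *)
Lemma competitor_min Omega P G H : competitor Omega P G ->
  {within Omega, continuous H} -> (forall x, Omega x -> 0 <= H x) ->
  (forall x, Omega° x -> exists A c, tropical_form H x A c) ->
  (forall x, P x -> G x <= H x \/ corner_locus Omega H x) ->
  competitor Omega P (G \min H)%O.
Proof.
move=> [[Gc G_ge0 G_bd G_form] GP] Hc H_ge0 H_form HP; split; first split.
- by move=> x; apply: continuous_min; [exact: Gc|exact: Hc].
- by move=> x xO; rewrite /= le_min G_ge0 // H_ge0.
- by move=> x xB; rewrite /= G_bd // min_l // H_ge0 //; case: xB.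
- move=> x xO; have [A1 [c1 G1]] := G_form _ xO; have [A2 [c2 H2]] := H_form _ xO.
  by exists (A1 ++ A2), (min_coef A1 c1 A2 c2); exact: tropical_form_min.
move=> x Px; have xO := (GP _ Px).1.
have [A1 [c1 G1]] := G_form _ xO; have [A2 [c2 H2]] := H_form _ xO.
have [GH|/ltW HG] := leP (G x) (H x); first exact: corner_locus_min (GP _ Px) H2 GH.
have [GH|HV] := HP _ Px; first exact: corner_locus_min (GP _ Px) H2 GH.
by rewrite min_funC; exact: corner_locus_min HV G1 HG.
Qed.

Lemma relaxation_le Omega P G x : competitor Omega P G -> Omega x ->
  relaxation Omega P x <= G x.
Proof.
move=> GC xO; apply: ge_inf; last by exists G.
by exists 0 => _ [G' [[_ G'_ge0 _ _] _] <-]; exact: G'_ge0.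
Qed.

(** A single finite list describes [F] on all of [Omega], boundary included, whereas
    [tropical_series] only provides lists varying from point to point. *)
Definition normal_form Omega F B c : Prop :=
  [/\ forall x, Omega x -> is_min_at F B c x,
      forall x, Omega x -> 0 <= F x &
      forall x, (Omega `\` Omega°) x -> F x = 0].

Definition int_box (L : nat) : seq 'rV[int]_2 :=
  [seq \row_j ((f j)%:Z - L%:Z) | f : {ffun 'I_2 -> 'I_(L + L).+1}].

Lemma mem_int_box L m : (forall j, - L%:Z <= m 0 j <= L%:Z) -> m \in int_box L.
Proof.
move=> mL; apply/mapP; exists [ffun j => inord (absz (m 0 j + L%:Z))].
  by rewrite mem_enum.
apply/rowP => j; have /andP[m_ge m_le] := mL j; rewrite !mxE ffunE.
have mL_ge0 : 0 <= m 0 j + L%:Z by rewrite -(opprK L%:Z) subr_ge0.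
rewrite inordK ?gez0_abs ?addrK // ltnS -lez_nat gez0_abs // PoszD.
by rewrite lerD2r.
Qed.

Section gradient_bound.
Variables (Omega : set 'rV[R]_2) (s : nat) (n : 'I_s -> 'rV[int]_2) (a : 'I_s -> R).
Hypothesis n_prim : forall r, primitive (n r).
Hypothesis OmegaE : Omega = [set x | forall r, 0 <= dot (lat R (n r)) x + a r].

Definition side_bound : nat := (\sum_r \sum_j absz (n r 0%R j)).+1%N.

Lemma dot_delta (p : 'rV[R]_2) j : dot p (delta_mx 0 j) = p 0 j.
Proof.
rewrite /dot (bigD1 j) //= big1 => [|i /negPf ij]; rewrite !mxE !eqxx /=.
  by rewrite mulr1n mulr1 addr0.
by rewrite ij mulr0.
Qed.

Lemma side_bound_ge r j : (absz (n r 0%R j) <= side_bound)%N.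
Proof.
by rewrite /side_bound (bigD1 r) //= (bigD1 j) //= -addnA ltnW // ltnS leq_addr.
Qed.

Lemma side_boundP r j : `|dot (lat R (n r)) (delta_mx 0 j)| <= side_bound%:R.
Proof.
rewrite dot_delta mxE -intr_norm [X in _ <= X]pmulrn ler_int -abszE lez_nat.
exact: side_bound_ge.
Qed.

Lemma mem_int_box_side r k : n r *+ k \in int_box (k * side_bound).
Proof.
apply: mem_int_box => j; have := side_bound_ge r j.
rewrite -lez_nat abszE ler_norml mulmxnE -mulr_natl natz PoszM -mulrN.
by move=> /andP[ge le]; rewrite !ler_wpM2l.
Qed.

(** Let [la] be the least constraint value at [x]. A step of [la / side_bound] along a coordinate
    axis stays in [Omega]; the affine function starts at no more than [k * la] and remains
    nonnegative, so its slope in that direction is at least [- k * side_bound]. *)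
Lemma gradient_bound (k : nat) (c0 : R) m x : (0 < k)%N -> Omega° x ->
  (forall y, Omega y -> 0 <= c0 + dot (lat R m) y) ->
  (forall r, c0 + dot (lat R m) x <= k%:R * (dot (lat R (n r)) x + a r)) ->
  m \in int_box (k * side_bound).
Proof.
move=> k0 xO l_ge0 l_le.
have x_gt0 := (polygon_interior x n_prim OmegaE).1 xO.
pose l0 := c0 + dot (lat R m) x.
have l0_ge0 : 0 <= l0 by apply: l_ge0; exact: interior_subset xO.
have k1 : 1 <= k%:R :> R by rewrite ler1n.
have T0 : 0 < side_bound%:R :> R by rewrite ltr0n.
have [la [la0 la_le la_l0]] : exists la : R, [/\ 0 < la,
    forall r, la <= dot (lat R (n r)) x + a r & l0 <= k%:R * la].
  have [s0|s0] := eqVneq (enum 'I_s) [::].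
    (* Without constraints, any positive number that is at least [l0] will do. *)
    exists (l0 + 1); split; [lra| |nra] => r.
    by have := mem_enum 'I_s r; rewrite s0.
  have [r _ rmin] := seq_argmin (fun r => dot (lat R (n r)) x + a r) s0.
  exists (dot (lat R (n r)) x + a r); split=> // r'; apply: rmin.
  by rewrite mem_enum.
have dir v : (forall r, `|dot (lat R (n r)) v| <= side_bound%:R) ->
    - (k%:R * side_bound%:R) <= dot (lat R m) v.
  move=> vT; pose t := la / side_bound%:R.
  have tE : t * side_bound%:R = la by rewrite divfK // gt_eqF.
  have t0 : 0 < t by rewrite divr_gt0.
  have /l_ge0 : Omega (x + t *: v).
    rewrite OmegaE => r /=; rewrite dotDr dotZr.
    have := vT r; rewrite ler_norml => /andP[v_ge _].
    by have := la_le r; nra.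
  rewrite dotDr dotZr; move: la_l0; rewrite /l0 -tE => la_l0.
  by move=> ?; nra.
apply: mem_int_box => j; rewrite -!(ler_int R) mulrNz -!pmulrn natrM.
have mj : dot (lat R m) (delta_mx 0 j) = (m 0 j)%:~R by rewrite dot_delta mxE.
rewrite -mj dir; last by move=> r; exact: side_boundP.
have := dir (- delta_mx 0 j); rewrite dotNr lerN2; apply=> r.
by rewrite dotNr normrN side_boundP.
Qed.

End gradient_bound.
End relaxation.

(** * The relaxation as a minimum of finitely many affine functions *)

Section relaxation_normal_form.
Variable R : realType.
Implicit Types (x y : 'rV[R]_2) (m : 'rV[int]_2) (Omega P : set 'rV[R]_2).
Implicit Types (F G H : 'rV[R]_2 -> R) (B : seq 'rV[int]_2) (c : 'rV[int]_2 -> R).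

(** The infimum of the empty set is 0 by convention, so without competitors the relaxation would be
    the zero function, which has no corners. *)
Lemma competitor_exists Omega P x :
  corner_locus Omega (relaxation Omega P) x -> competitor Omega P !=set0.
Proof.
move=> xV; apply: contrapT => C0.
have F0 y : relaxation Omega P y = 0.
  rewrite /relaxation (_ : [set _ | _ in _] = set0) ?inf0 //.
  by apply/seteqP; split=> [z [G GC _]|z []]; apply: C0; exists G.
apply: (@corner_locus_nonaffine _ Omega (relaxation Omega P) x 0 0) xV.
by apply: (@filterE _ (nbhs x)) => y; rewrite F0 add0r dot_lat0.
Qed.

(** All competitors that matter have their gradients in one finite box, so the infimum of functions
    reduces to an infimum of constants for each gradient of the box. *)
Lemma relaxation_normal_form Omega N (p : 'I_N -> 'rV[R]_2) :
  rational_polygon Omega ->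
  corner_locus Omega (relaxation Omega (range p)) !=set0 ->
  exists B c, normal_form Omega (relaxation Omega (range p)) B c.
Proof.
move=> OP [x0 x0V]; have [G0 G0C] := competitor_exists x0V.
have [_ _ [s [n [a [n_prim OmegaE]]]]] := OP.
set F := relaxation Omega (range p).
pose l r y := dot (lat R (n r)) y + a r.
have l_ge0 r y : Omega y -> 0 <= l r y by rewrite OmegaE; apply.
have l_gt0 r y : Omega° y -> 0 < l r y by move=> /(polygon_interior y n_prim OmegaE); apply.
have pO i : Omega° (p i) by have [] := G0C.2 (p i) (ex_intro2 _ _ i I erefl).
(* With this [k], the function [k * l r] is at least [G0] at every marked point, so cutting by it
   will preserve the corners there. *)
have [k k0 kG0] : exists2 k : nat, (0 < k)%N &
    forall i r, G0 (p i) <= k%:R * l r (p i).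
  pose b (ir : 'I_N * 'I_s) := Num.bound (G0 (p ir.1) / l ir.2 (p ir.1)).
  exists (\max_ir b ir).+1 => // i r.
  have := l_gt0 r _ (pO i) => lri; rewrite -ler_pdivrMr //.
  have G_ge0 : 0 <= G0 (p i) / l r (p i).
    rewrite divr_ge0 ?(ltW lri) //; case: G0C => -[_ G0_ge0 _ _] _.
    exact: G0_ge0 (interior_subset (pO i)).
  apply: le_trans (ltW (archi_boundP G_ge0)) _.
  by rewrite ler_nat leqW // (leq_bigmax (F := b) (i, r)).
pose small G := forall r y, Omega y -> G y <= k%:R * l r y.
have shrink G : competitor Omega (range p) G -> exists G1, [/\ competitor Omega (range p) G1,
    small G1 & forall y, G1 y <= G y].
  move=> GC.
  suff [G1 [G1C G1G _ G1l]] : exists G1, [/\ competitor Omega (range p) G1,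
      forall y, G1 y <= G y, forall y, G1 y <= G0 y &
      forall r, r \in enum 'I_s -> forall y, Omega y -> G1 y <= k%:R * l r y].
    by exists G1; split=> // r; apply: G1l; rewrite mem_enum.
  (* The sides are cut one at a time. Staying below [G0] is carried along because it keeps [G1]
     below the next cut at the marked points. *)
  elim: (enum 'I_s) => [|r rs [G1 [G1C G1G G1G0 G1l]]].
    exists (G \min G0)%O; split=> // [|y|y]; try by rewrite /= ge_min lexx ?orbT.
    have [[G0c G0_ge0 G0_bd G0_form] G0V] := G0C.
    by apply: competitor_min => // y /G0V; right.
  pose H y := aff (fun=> k%:R * a r) (n r *+ k) y.
  have HE y : H y = k%:R * l r y.
    by rewrite /H /aff /l mulrDr addrC dot_latMn.
  exists (G1 \min H)%O; split.
  - apply: competitor_min => //.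
    + by apply: continuous_subspaceT; exact: aff_continuous.
    + by move=> y yO; rewrite HE mulr_ge0 // l_ge0.
    + move=> y _; exists [:: n r *+ k], (fun=> k%:R * a r); apply: (@filterE _ (nbhs y)) => z; split.
        by exists (n r *+ k); rewrite ?mem_head.
      by move=> m; rewrite inE => /eqP ->.
    + by move=> _ [i _ <-]; left; rewrite HE; apply: le_trans (G1G0 _) (kG0 _ _).
  - by move=> y; rewrite /= ge_min G1G.
  - by move=> y; rewrite /= ge_min G1G0.
  - move=> r' /[!inE] /predU1P[->|r'rs] y yO; rewrite /= ge_min.
      by rewrite -HE lexx orbT.
    by rewrite G1l.
(* The coefficient of [m] is the infimum of the constants for which an affine
   function of gradient [m] dominates some small competitor. *)
pose D m := [set e : R | exists G, [/\ competitor Omega (range p) G, small G &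
  forall y, Omega y -> G y <= e + dot (lat R m) y]].
pose c m := inf (D m).
pose B := [seq m <- int_box (k * side_bound n) | `[< D m !=set0 >]].
have x0O : Omega x0 by case: x0V => /interior_subset.
have D_lb m : has_lbound (D m).
  exists (- dot (lat R m) x0) => e [G [[[_ G_ge0 _ _] _] _ /(_ _ x0O)]].
  by have := G_ge0 _ x0O; lra.
have F_ge0 y : Omega y -> 0 <= F y.
  move=> yO; apply: lb_le_inf; first by exists (G0 y), G0.
  by move=> _ [G [[_ G_ge0 _ _] _] <-]; exact: G_ge0.
have F_le y m : m \in B -> Omega y -> F y <= aff c m y.
  rewrite mem_filter => /andP[/asboolP Dm _] yO; rewrite -lerBlDr.
  apply: lb_le_inf => // e [G [GC _ Ge]]; rewrite lerBlDr.
  exact: le_trans (relaxation_le GC yO) (Ge _ yO).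
have support G y m e : competitor Omega (range p) G -> small G -> Omega° y ->
    (forall z, Omega z -> G z <= e + dot (lat R m) z) ->
    G y = e + dot (lat R m) y -> m \in B /\ aff c m y <= G y.
  move=> GC Gs yO Ge Gy.
  have De : D m e by exists G.
  split; last by rewrite Gy lerD2r; apply: ge_inf.
  rewrite mem_filter; apply/andP; split; first by apply/asboolP; exists e.
  have [[_ G_ge0 _ _] _] := GC.
  apply: (gradient_bound n_prim OmegaE (c0 := e) k0 yO) => [z zO|r].
    exact: le_trans (G_ge0 _ zO) (Ge _ zO).
  by rewrite -Gy; apply: Gs; exact: interior_subset yO.
(* Otherwise some competitor lies at [y] strictly below all functions of the list. Once shrunk, it
   is supported at [y] by one of its own affine functions, whose gradient is in [B] and whose value
   at [y] is too small. *)
have F_int y : Omega° y -> exists2 m, m \in B & F y = aff c m y.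
  move=> yO; have yO' := interior_subset yO.
  apply: contrapT => noeq.
  have F_lt m : m \in B -> F y < aff c m y.
    move=> mB; rewrite lt_def F_le // andbT; apply/eqP => Fy.
    by apply: noeq; exists m.
  have [d Fd dle] : exists2 d, F y < d & forall m, m \in B -> d <= aff c m y.
    have [B0|B0] := eqVneq B [::]; first by exists (F y + 1); [lra|rewrite B0].
    have [m mB mmin] := seq_argmin (fun m => aff c m y) B0.
    by exists (aff c m y) => //; exact: F_lt.
  have [|_ [G GC <-] Gd] := inf_lt _ Fd; first by exists (G0 y), G0.
  have [G1 [G1C G1s G1G]] := shrink _ GC.
  have [[G1S _] G1y] := (G1C, G1G y).
  have [_ _ _ /(_ y yO)[A [c1 G1f]]] := G1S.
  have [[m mA Gm] _] := nbhs_singleton G1f.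
  have Gle : \forall z \near y, G1 z <= c1 m + dot (lat R m) z.
    by apply: filterS G1f => z [_]; apply.
  have Gglob := supergradient_global OP G1S yO Gle Gm.
  have [mB] := support _ _ _ _ G1C G1s yO Gglob Gm.
  by have := dle _ mB; lra.
have F_bd y : (Omega `\` Omega°) y -> F y = 0.
  move=> [yO ynO]; apply/eqP; rewrite eq_le F_ge0 // andbT.
  have [[_ _ /(_ y (conj yO ynO)) G0y _] _] := G0C.
  by rewrite -G0y relaxation_le.
exists B, c; split=> // y yO; split; last by move=> m mB; exact: F_le.
have [/F_int//|ynO] := pselect (Omega° y).
(* On the side [r] the minimum 0 is attained at the gradient [n r *+ k]: the function [k * l r]
   dominates all small competitors and vanishes at [y]. *)
have [r lr] : exists r, l r y = 0.
  apply: contrapT => lx0; apply: ynO; apply/(polygon_interior _ n_prim OmegaE) => r.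
  rewrite lt_def [X in _ && X]l_ge0 // andbT; apply/eqP => lry; apply: lx0; exists r; exact: lry.
have [G1 [G1C G1s _]] := shrink _ G0C.
have De : D (n r *+ k) (k%:R * a r).
  exists G1; split=> // z zO; rewrite dot_latMn addrC.
  by rewrite -mulrDr G1s.
have mB : n r *+ k \in B.
  rewrite mem_filter; apply/andP; split; first by apply/asboolP; exists (k%:R * a r).
  exact: mem_int_box_side.
exists (n r *+ k) => //; apply/eqP; rewrite eq_le F_le //= F_bd //.
apply: (@le_trans _ _ (k%:R * l r y)); last by rewrite lr mulr0.
rewrite /aff dot_latMn mulrDr addrC lerD2l.
exact: ge_inf.
Qed.

End relaxation_normal_form.

(** * Irredundant presentations and the complementary cells *)

Section cells.
Variable R : realType.
Implicit Types (p x y z : 'rV[R]_2) (m : 'rV[int]_2).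

Lemma near_aff_lt c m m' x : @aff R c m x < aff c m' x ->
  \forall y \near x, aff c m y < aff c m' y.
Proof.
move=> lt.
have /near_dot_gt0 : 0 < dot (lat R m' - lat R m) x + (c m' - c m).
  by move: lt; rewrite /aff dotBl; lra.
by apply: filterS => y; rewrite /aff dotBl; lra.
Qed.

Definition open_cell (Omega : set 'rV[R]_2) (B : seq 'rV[int]_2) c m : set 'rV[R]_2 :=
  [set x | Omega° x /\ forall m', m' \in B -> m' != m -> aff c m x < aff c m' x].

Lemma irredundant_normal_form Omega F B c : rational_polygon Omega ->
  @normal_form R Omega F B c ->
  exists2 B', normal_form Omega F B' c &
    forall m, m \in B' -> open_cell Omega B' c m !=set0.
Proof.
move=> OP; have [k] := ubnP (size B); elim: k B => // k IH B szB FB.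
have [irr|] := pselect (forall m, m \in B -> open_cell Omega B c m !=set0).
  by exists B.
move=> /existsNP[m /not_implyP[mB U0]].
apply: (IH [seq m' <- B | m' != m]).
  apply: (@leq_trans (size B)) => //.
  rewrite size_filter -(count_predC (fun m' => m' != m) B) -addn1 leq_add2l.
  by rewrite -has_count; apply/hasP; exists m; rewrite //= eqxx.
have [Fmin F_ge0 F_bd] := FB; split=> // x xO; have [[m1 m1B Fm1] Fle] := Fmin _ xO.
split; last by move=> m'; rewrite mem_filter => /andP[_]; exact: Fle.
apply: contrapT => noeq.
have lt m' : m' \in B -> m' != m -> F x < aff c m' x.
  move=> m'B m'm; rewrite lt_def Fle // andbT; apply/eqP => Fm'.
  by apply: noeq; exists m' => //; rewrite mem_filter m'm.
have m1m : m1 = m.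
  by apply/eqP; apply: contraT => /(lt _ m1B); rewrite Fm1 ltxx.
have [_ [z zO] _] := OP.
have near_lt : \forall y \near x, forall m', m' \in B -> m' != m -> aff c m y < aff c m' y.
  apply: (@near_seq _ _ B (nbhs x) (fun m' y => m' != m -> aff c m y < aff c m' y)) => m' m'B.
  have [m'm|_] := boolP (m' != m); last exact: filterE.
  have /near_aff_lt : aff c m x < aff c m' x by rewrite -m1m -Fm1 lt.
  exact: filterS.
apply: U0.
have [t t0 [[tlt t1] _]] : exists2 t : R, 0 < t &
   ((forall m', m' \in B -> m' != m ->
     aff c m (x + t *: (z - x)) < aff c m' (x + t *: (z - x))) /\ t < 1) /\
   ((forall m', m' \in B -> m' != m ->
     aff c m (x + - t *: (z - x)) < aff c m' (x + - t *: (z - x))) /\ - t < 1).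
  apply: near0_pm; apply: filterI; first exact: nbhs_line near_lt.
  exact: (open_nbhs_nbhs (conj (@open_lt R 1) (@ltr01 R))).
exists (x + t *: (z - x)); split=> //; apply: polygon_ray => //.
by rewrite t0 ltW.
Qed.

Variables (Omega : set 'rV[R]_2) (F : 'rV[R]_2 -> R).
Variables (B : seq 'rV[int]_2) (c : 'rV[int]_2 -> R).
Hypothesis OP : rational_polygon Omega.
Hypothesis FB : normal_form Omega F B c.
Hypothesis B_irr : forall m, m \in B -> open_cell Omega B c m !=set0.
Local Notation U := (open_cell Omega B c).
Local Notation Gamma := (corner_locus Omega F).

Let F_le x m : Omega x -> m \in B -> F x <= aff c m x.
Proof. by case: FB => + _ _ => /[apply] -[_]; apply. Qed.

Let F_eq x : Omega x -> exists2 m, m \in B & F x = aff c m x.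
Proof. by case: FB => + _ _ => /[apply] -[]. Qed.

Lemma open_cell_eq m x : m \in B -> U m x -> F x = aff c m x.
Proof.
move=> mB [/interior_subset xO Um]; have [m' m'B Fm'] := F_eq xO.
have [<-//|/(Um _ m'B)] := eqVneq m' m.
by rewrite -Fm' ltNge F_le.
Qed.

Lemma open_cell_open m : open (U m).
Proof.
rewrite openE => x [xO Um]; apply: filterI; first exact: nbhs_interior.
apply: (@near_seq _ _ B (nbhs x) (fun m' y => m' != m -> aff c m y < aff c m' y)) => m' m'B.
have [m'm|_] := boolP (m' != m); last exact: filterE.
by apply: filterS (near_aff_lt (Um _ m'B m'm)) => y.
Qed.

Lemma open_cell_conv m : conv_set (U m).
Proof.
move=> x y t [xO xU] [yO yU] /andP[t0 t1].
have [->|t_neq0] := eqVneq t 0; first by rewrite scale0r addr0.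
split; first by apply: polygon_ray => //; [exact: interior_subset|rewrite lt_def t_neq0 t0].
move=> m' m'B m'm; have := xU _ m'B m'm; have := yU _ m'B m'm.
by rewrite /aff !dotR; nra.
Qed.

(** From a point where [m] is active, possibly along with others, every short step towards a point
    of the open cell makes all inequalities strict. Irredundancy supplies such a point. *)
Lemma closure_open_cell m : m \in B ->
  closure (U m) = Omega `&` [set x | F x = aff c m x].
Proof.
move=> mB; apply/seteqP; split=> x.
  move=> xU; have xO : Omega x.
    apply: (polygon_closed OP); apply: closureS xU => y [+ _].
    exact: interior_subset.
  split=> //=; apply/eqP; rewrite eq_le F_le //= leNgt; apply/negP.
  have [m' m'B ->] := F_eq xO => /near_aff_lt/xU[y [[_ Uy] yl]].
  have [m'm|/(Uy _ m'B)] := eqVneq m' m; first by move: yl; rewrite m'm /= ltxx.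
  by move=> /lt_trans/(_ yl); rewrite ltxx.
move=> [xO /= Fx] V /(nbhs_line _) xV; have [y Uy] := B_irr mB.
have [t t0 [[Vt t1] _]] : exists2 t : R, 0 < t &
   (V (x + t *: (y - x)) /\ t < 1) /\ (V (x + - t *: (y - x)) /\ - t < 1).
  apply: near0_pm; apply: filterI; first exact: xV.
  exact: (open_nbhs_nbhs (conj (@open_lt R 1) (@ltr01 R))).
exists (x + t *: (y - x)); split=> //; case: Uy => yO Uy; split.
  by apply: polygon_ray => //; rewrite t0 ltW.
move=> m' m'B m'm; have := Uy _ m'B m'm; have := F_le xO m'B.
rewrite Fx /aff !dotR => Fle Ult; nra.
Qed.

Lemma near_open_cell m x : m \in B -> U m x -> \forall y \near x, F y = aff c m y.
Proof.
move=> mB xU; have : nbhs x (U m) by apply: open_nbhs_nbhs; split=> //; exact: open_cell_open.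
by apply: filterS => y; exact: open_cell_eq.
Qed.

Lemma normal_form_tropical x : Omega° x -> tropical_form F x B c.
Proof. by apply: filterS; case: FB. Qed.

Lemma corner_locusP x : Gamma x <-> Omega° x /\ exists m1 m2,
  [/\ m1 \in B, m2 \in B, m1 != m2, F x = aff c m1 x & F x = aff c m2 x].
Proof.
split=> [xV|[xO ex]]; last first.
  by split=> //; exists B, c; split=> //; exact: normal_form_tropical.
have xO := xV.1; have xO' := interior_subset xO; split=> //; apply: contrapT => noex.
have [m mB Fm] := F_eq xO'.
apply: (@corner_locus_nonaffine _ Omega F x (c m) m) xV.
apply: near_open_cell => //; split=> // m' m'B m'm; rewrite -Fm lt_def F_le // andbT.
by apply/eqP => Fm'; apply: noex; exists m', m.
Qed.

Lemma open_cell_compl m x : m \in B -> U m x -> (Omega° `\` Gamma) x.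
Proof.
move=> mB xU; split; first by case: xU.
exact: corner_locus_nonaffine (near_open_cell mB xU).
Qed.

Lemma compl_open_cell m x : m \in B -> F x = aff c m x -> (Omega° `\` Gamma) x -> U m x.
Proof.
move=> mB Fx [xO xV]; split=> // m' m'B m'm.
rewrite -Fx lt_def F_le ?andbT //; last exact: interior_subset.
by apply/eqP => Fm'; apply/xV/corner_locusP; split=> //; exists m', m.
Qed.

(** The open cell is convex, hence connected, and it is open. It is also closed in the complement of
    [Gamma], since off [Gamma] an active gradient is the only active one. *)
Lemma component_open_cell m x : m \in B -> U m x ->
  connected_component (Omega° `\` Gamma) x = U m.
Proof.
move=> mB xU; set K := connected_component _ _.
have KO : K `<=` Omega° `\` Gamma by exact: connected_component_sub.
have UK : U m `<=` K.
  apply: connected_component_max => //; first by move=> y; exact: open_cell_compl.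
  exact: conv_set_connected (@open_cell_conv m).
apply/esym/(@component_connected _ (Omega° `\` Gamma) x (U m)); first by exists x.
- exists (U m); first exact: open_cell_open.
  by rewrite setIidr.
- exists (closure (U m)); first exact: closed_closure.
  apply/seteqP; split=> [y yU|y [yK]]; first by split; [exact: UK|exact: subset_closure].
  rewrite closure_open_cell // => -[_ /= Fy].
  exact: compl_open_cell (KO _ yK).
Qed.

Lemma bounded_cellE : bounded_cell Omega Gamma =
  [set U m | m in [set m | m \in B /\ closure (U m) `<=` Omega°]].
Proof.
apply/seteqP; split=> [C [[x xO CE] CO]|C [m [mB Um] <-]].
  have [m mB Fm] := F_eq (interior_subset xO.1).
  have xU := compl_open_cell mB Fm xO.
  by move: CO; rewrite CE (component_open_cell mB xU) => CO; exists m.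
split=> //; have [x xU] := B_irr mB.
by exists x; [exact: open_cell_compl mB xU|rewrite (component_open_cell mB xU)].
Qed.

Lemma open_cell_inj m m' : m \in B -> m' \in B -> U m = U m' -> m = m'.
Proof.
move=> mB m'B Umm'; have [x xU] := B_irr mB; have xU' := xU; rewrite Umm' in xU'.
apply/eqP; apply: contraT => mm'; have := xU'.2 _ mB mm'.
by rewrite -(open_cell_eq mB xU) -(open_cell_eq m'B xU') ltxx.
Qed.

(** For maximality: the affine formula for [F] on a larger region agrees with [aff c m] near a point
    of the open cell, hence identically, and a locally affine function with integral gradient has no
    corners. *)
Lemma cell_open_cell m : m \in B -> cell Omega F (closure (U m)).
Proof.
move=> mB; have [x xU] := B_irr mB; exists (U m); split=> //.
  split; [exact: open_cell_open|exact: conv_set_connected (@open_cell_conv m)| |].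
    by move=> y [].
  by exists (c m), (lat R m) => y; exact: open_cell_eq.
move=> U' [oU' _ U'O [c0 [p Fp]]] UU'; apply/seteqP; split=> // y yU'.
have xU' := UU' _ xU.
have px : p = lat R m.
  have Fpx := near_open_cell mB xU.
  apply: (@affine_touch _ x c0 (c m)); last by rewrite -Fp // (open_cell_eq mB xU).
  have : nbhs x U' by exact: (open_nbhs_nbhs (conj oU' xU')).
  by apply: filterS2 Fpx => z Fz /Fp <-; rewrite Fz.
have cx : c0 = c m.
  by have := Fp _ xU'; rewrite (open_cell_eq mB xU) /aff px => /addIr.
have Fy : F y = aff c m y by rewrite Fp // px cx.
apply: compl_open_cell => //; split; first exact: U'O.
apply: (@corner_locus_nonaffine _ Omega F y c0 m).
have : nbhs y U' by exact: (open_nbhs_nbhs (conj oU' yU')).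
by apply: filterS => z /Fp ->; rewrite px.
Qed.

(** At a point of the open region some function of the list is active; touching identifies it with
    the given one, which therefore dominates [F] everywhere. *)
Lemma cell_majorant C (e : R) m : cell Omega F C -> C !=set0 ->
  (forall x, C x -> F x = e + dot (lat R m) x) ->
  forall x, Omega x -> F x <= e + dot (lat R m) x.
Proof.
move=> [U' [[oU' _ U'O _] _ ->]] [y /(_ setT filterT)[x [xU' _]]] Fe.
have xO := interior_subset (U'O _ xU'); have [m' m'B Fm'] := F_eq xO.
have Fx := Fe _ (subset_closure xU').
have mm' : m = m'.
  apply: (@aff_touch _ x (fun=> e) c); last by rewrite -Fm' /aff -Fx.
  have : nbhs x U' by exact: (open_nbhs_nbhs (conj oU' xU')).
  apply: filterS => z zU'; rewrite /aff -Fe; last exact: subset_closure.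
  by apply: F_le => //; exact: interior_subset (U'O _ zU').
have -> : e = c m by move: Fm'; rewrite Fx -mm' => /addIr.
by move=> z zO; apply: F_le => //; rewrite mm'.
Qed.

End cells.

(** * Vertices, edges and the two cells along an edge *)

Section edges.
Variable R : realType.
Implicit Types (p v x y z : 'rV[R]_2) (m : 'rV[int]_2).

Lemma affine_hull_line S x y (t : R) : S x -> S y ->
  affine_hull S (x + t *: (y - x)).
Proof.
move=> Sx Sy; exists 2, (fun i : 'I_2 => if i == 0 then 1 - t else t),
  (fun i : 'I_2 => if i == 0 then x else y); split.
- by rewrite !big_ord_recl big_ord0 /= addr0 subrK.
- by move=> i; case: ifP.
- rewrite !big_ord_recl big_ord0 /= addr0 scalerBr scalerBl scale1r.
  by rewrite addrA addrAC.
Qed.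

(** Decomposition of [v2] along [v1] and its quarter turn [J v1]: [|v1|^2 v2 = <v1, v2> v1 + det2 v1
    v2 J v1]. *)
Lemma det2_eq0 v1 v2 : v1 != 0 -> det2 v1 v2 = 0 ->
  v2 = (dot v1 v2 / dot v1 v1) *: v1.
Proof.
move=> v10; set D := det2 v1 v2 => det0; have d0 := dot_gt0 v10.
apply: (@scalerI _ _ (dot v1 v1)); first by rewrite gt_eqF.
rewrite scalerA mulrCA divff ?gt_eqF // mulr1; apply: row2P; rewrite !dotE !mxE.
  transitivity (dot v1 v2 * v1 0 0 - v1 0 1 * D); last by rewrite det0 mulr0 subr0 dotE.
  by rewrite !dotE /D /det2; ring.
transitivity (dot v1 v2 * v1 0 1 + v1 0 0 * D); last by rewrite det0 mulr0 addr0 dotE.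
by rewrite !dotE /D /det2; ring.
Qed.

Lemma det2_orthogonal u1 u2 v : v != 0 -> dot u1 v = 0 -> dot u2 v = 0 ->
  det2 u1 u2 = 0.
Proof.
move=> v0; rewrite -dot_eq0 in v0; rewrite /det2.
set D := _ - _ => u1v u2v; apply/eqP; have : D * dot v v == 0.
  rewrite /D; apply/eqP; move: u1v u2v; rewrite !dotE.
  set a1 := u1 0 0; set a2 := u1 0 1; set b1 := u2 0 0; set b2 := u2 0 1.
  move=> u1v u2v.
  transitivity ((v 0 0 * b2 - v 0 1 * b1) * (a1 * v 0 0 + a2 * v 0 1) +
     (v 0 1 * a1 - v 0 0 * a2) * (b1 * v 0 0 + b2 * v 0 1)); first by ring.
  by rewrite u1v u2v !mulr0 addr0.
by rewrite mulf_eq0 (negPf v0) orbF.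
Qed.

Variables (Omega : set 'rV[R]_2) (F : 'rV[R]_2 -> R).
Variables (B : seq 'rV[int]_2) (c : 'rV[int]_2 -> R).
Hypothesis OP : rational_polygon Omega.
Hypothesis FB : normal_form Omega F B c.
Hypothesis B_irr : forall m, m \in B -> open_cell Omega B c m !=set0.
Local Notation U := (open_cell Omega B c).
Local Notation Gamma := (corner_locus Omega F).

Let F_le x m : Omega x -> m \in B -> F x <= aff c m x.
Proof. by case: FB => + _ _ => /[apply] -[_]; apply. Qed.

Lemma superdiff_active m x : Omega x -> m \in B -> F x = aff c m x ->
  superdiff Omega F x (lat R m).
Proof.
by move=> xO mB Fx y yO; have := F_le yO mB; rewrite Fx /aff !dotR; lra.
Qed.

(** If [m0] were such a combination, the three values being equal at [x], then [aff c m0] would be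
    the same combination of the other two functions everywhere, and could not be below both on its
    open cell. *)
Lemma not_middle_gradient m0 m1 m2 x (t : R) :
  m0 \in B -> m1 \in B -> m2 \in B -> m1 != m0 -> m2 != m0 ->
  F x = aff c m0 x -> F x = aff c m1 x -> F x = aff c m2 x ->
  0 < t < 1 -> lat R m0 <> (1 - t) *: lat R m1 + t *: lat R m2.
Proof.
move=> m0B m1B m2B m10 m20 F0 F1 F2 /andP[t0 t1] m0E.
have [y [_ Uy]] := B_irr m0B; have := Uy _ m1B m10; have := Uy _ m2B m20.
move: F0 F1 F2; rewrite /aff m0E !dotR => F0 F1 F2.
set d1 := dot (lat R m1) y; set d2 := dot (lat R m2) y => l2 l1.
nra.
Qed.

(** Active gradients are supergradients. Were the three collinear, one would lie strictly between
    the other two. *)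
Lemma three_active_vertex m0 m1 m2 x : Omega° x ->
  m0 \in B -> m1 \in B -> m2 \in B -> m0 != m1 -> m0 != m2 -> m1 != m2 ->
  F x = aff c m0 x -> F x = aff c m1 x -> F x = aff c m2 x ->
  vertex Omega F x.
Proof.
move=> xO m0B m1B m2B m01 m02 m12 F0 F1 F2; have xO' := interior_subset xO.
split=> //; exists (lat R m0), (lat R m1), (lat R m2).
split; try exact: superdiff_active.
apply/eqP; set v1 := _ - _; set v2 := _ - _ => det0.
have v10 : v1 != 0 by rewrite subr_eq0 (inj_eq (@lat_inj R)) eq_sym.
have v20 : v2 != 0 by rewrite subr_eq0 (inj_eq (@lat_inj R)) eq_sym.
have := det2_eq0 v10 det0; set s := _ / _ => v2E.
have m2E : lat R m2 = lat R m0 + s *: (lat R m1 - lat R m0).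
  by rewrite -/v1 -v2E addrC subrK.
have s0 : s != 0 by apply: contraNneq v20 => s0; rewrite v2E s0 scale0r.
have s1 : s != 1.
  apply: contraNneq m12 => s1; rewrite -(inj_eq (@lat_inj R)) m2E s1 scale1r.
  by rewrite addrC subrK.
(* The middle gradient is [m0] for [s < 0], [m2] for [0 < s < 1] and [m1] for [s > 1]. *)
have [s_lt0|s_gt0|/eqP] := ltgtP s 0; last by rewrite (negPf s0).
  apply: (@not_middle_gradient m0 m1 m2 x (1 - s)^-1) => //; try by rewrite eq_sym.
    have s_gt1 : 1 < 1 - s by lra.
    by rewrite invr_gt0 invf_lt1 ?(lt_trans ltr01) ?s_gt1.
  rewrite m2E; apply/rowP => i; rewrite !mxE; field; apply/eqP; lra.
have [s_lt1|s_gt1|/eqP] := ltgtP s 1; last by rewrite (negPf s1).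
  apply: (@not_middle_gradient m2 m0 m1 x s) => //.
    by rewrite s_gt0 s_lt1.
  by rewrite m2E; apply/rowP => i; rewrite !mxE; ring.
apply: (@not_middle_gradient m1 m0 m2 x s^-1) => //; try by rewrite eq_sym.
  by rewrite invr_gt0 s_gt0 invf_lt1.
rewrite m2E; apply/rowP => i; rewrite !mxE; field; exact: s0.
Qed.

Definition two_cells m0 m1 e : Prop :=
  [/\ m0 \in B, m1 \in B, m0 != m1 & e `<=` closure (U m0) `&` closure (U m1)].

(** The two gradients active at the base point stay active along the edge. The part of the component
    where both are active is closed; it is also open, because with no vertex around all other
    functions are strictly larger there, and every point of [Gamma] has two active gradients. *)
Lemma edge_two_cells e : edge Omega F e -> exists m0 m1, two_cells m0 m1 e.
Proof.
move=> [x [xV xnv] ->]; set E := Gamma `\` _; set K := connected_component _ _.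
have [xO [m0 [m1 [m0B m1B m01 F0 F1]]]] := (corner_locusP FB x).1 xV.
exists m0, m1; split=> //.
have cU m : m \in B -> closure (U m) = Omega `&` [set x | F x = aff c m x].
  exact: closure_open_cell.
pose W := closure (U m0) `&` closure (U m1).
have cW : closed W by apply: closedI; exact: closed_closure.
suff KW : K `<=` W by rewrite -/W (closure_id W).1 //; exact: closureS.
have KE : K `<=` E by exact: connected_component_sub.
have other m y : K y -> W y -> m \in B -> m != m0 -> m != m1 -> aff c m0 y < aff c m y.
  move=> /KE[yV yv] []; rewrite !cU // => -[yO /= F0y] [_ /= F1y] mB mm0 mm1.
  rewrite -F0y lt_def F_le // andbT; apply/eqP => Fy; apply: yv.
  by apply: (@three_active_vertex m0 m1 m y) => //; [case: yV|rewrite eq_sym|rewrite eq_sym].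
pose O := [set y | forall m, m \in B -> m != m0 -> m != m1 -> aff c m0 y < aff c m y].
suff -> : K = K `&` W by move=> y [].
apply/esym/(@component_connected _ E x (K `&` W)).
- exists x; split; first by apply: connected_component_refl.
  by split; rewrite cU //; split=> //; exact: interior_subset.
- exists O.
    rewrite openE => y yO; apply: (@near_seq _ _ B (nbhs y)
      (fun m y => m != m0 -> m != m1 -> aff c m0 y < aff c m y)) => m mB.
    have [mm0|_] := boolP (m != m0); last exact: filterE.
    have [mm1|_] := boolP (m != m1); last exact: filterE.
    by apply: filterS (near_aff_lt (yO _ mB mm0 mm1)).
  apply/seteqP; split=> y [yK yW]; split=> //.
    by move=> m mB mm0 mm1; exact: other.
  have [yV _] := KE _ yK.
  have [yO [m2 [m3 [m2B m3B m23 F2 F3]]]] := (corner_locusP FB y).1 yV.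
  have yO' := interior_subset yO.
  have m01P m : m \in B -> F y = aff c m y -> m = m0 \/ m = m1.
    move=> mB Fm; have [->|mm0] := eqVneq m m0; first by left.
    have [->|mm1] := eqVneq m m1; first by right.
    by have := yW _ mB mm0 mm1; rewrite -Fm ltNge F_le.
  have [Fm0 Fm1] : F y = aff c m0 y /\ F y = aff c m1 y.
    have [E2|E2] := m01P _ m2B F2; have [E3|E3] := m01P _ m3B F3;
    by move: m23 F2 F3; rewrite E2 E3 ?eqxx.
  by split; rewrite cU.
- by exists W.
Qed.

(** On the edge [F] agrees with one affine function, on both sides of [x] in the direction [v]. All
    supergradients at [x] thus have the same product with [v] and lie on a line. *)
Lemma relint_edge_not_vertex e x : Omega° x -> edge Omega F e -> relint e x ->
  ~ vertex Omega F x.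
Proof.
move=> xO eE; have [m0 [m1 [m0B _ _ eU]]] := edge_two_cells eE.
have eF y : e y -> Omega y /\ F y = aff c m0 y.
  by move=> /eU[+ _]; rewrite (closure_open_cell OP FB B_irr m0B).
have [z [zV zv] eE'] := eE.
move=> [xe xe_near]; have ze : e z.
  by rewrite eE'; apply: subset_closure; exact: connected_component_refl.
have [->//|zx] := eqVneq x z.
pose v := z - x; have v0 : v != 0 by rewrite subr_eq0 eq_sym.
have [t t0 [ep em]] : exists2 t : R, 0 < t &
    (affine_hull e (x + t *: v) -> e (x + t *: v)) /\
    (affine_hull e (x + - t *: v) -> e (x + - t *: v)).
  exact: near0_pm (nbhs_line v xe_near).
have [pO Fp] := eF _ (ep (affine_hull_line t xe ze)).
have [mO Fm] := eF _ (em (affine_hull_line (- t) xe ze)).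
have [_ Fx] := eF _ xe.
have super p : superdiff Omega F x p -> dot p v = dot (lat R m0) v.
  move=> sp; have := sp _ pO; have := sp _ mO; rewrite Fp Fm Fx /aff.
  rewrite !dotR => h1 h2; nra.
move=> [_ [p0 [p1 [p2 [/super s0 /super s1 /super s2 /eqP]]]]]; apply.
by apply: (det2_orthogonal v0); rewrite dotBl ?s0 ?s1 ?s2 subrr.
Qed.

Lemma relint_edge_active e x m0 m1 : Omega° x -> edge Omega F e -> relint e x ->
  two_cells m0 m1 e -> forall m, m \in B ->
  (closure (U m) x <-> m = m0 \/ m = m1).
Proof.
move=> xO eE xe [m0B m1B m01 eU] m mB.
have xv := relint_edge_not_vertex xO eE xe.
have xO' := interior_subset xO; have [x0 x1] := eU _ xe.1.
split=> [xm|[->|->] //].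
have [->|mm0] := eqVneq m m0; first by left.
have [->|mm1] := eqVneq m m1; first by right.
exfalso; apply: xv; move: xm x0 x1; rewrite !(closure_open_cell OP FB B_irr) //.
by move=> [_ /= ?] [_ /= ?] [_ /= ?]; exact: (@three_active_vertex m m0 m1).
Qed.

End edges.

(** * Determinants of incidence matrices of directed graphs *)

Section unimodular.

(** Each row has at most one 1 and at most one -1: edge-vertex incidences of a directed graph from
    which vertices may have been deleted. *)
Definition signed_incidence n (A : 'M[int]_n) : Prop := forall i,
  (forall j, [\/ A i j = 0, A i j = 1 | A i j = -1]) /\
  (forall j j', j != j' -> A i j = A i j' -> A i j = 0).

(* If every row of [A] sums to [0], then [A] kills the all-one vector;
   otherwise some row has at most one nonzero entry, along which the determinant
   is expanded. *)
Lemma det_signed_incidence n (A : 'M[int]_n) : signed_incidence A ->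
  [\/ \det A = 0, \det A = 1 | \det A = -1].
Proof.
elim: n A => [A _|n IH A inc]; first by rewrite det_mx00; constructor 2.
have [row0|] := pselect (forall i, \sum_j A i j = 0).
  constructor 1; have A1 : A *m const_mx 1 = 0 :> 'cV_n.+1.
    by apply/colP => i; rewrite !mxE -[RHS](row0 i); apply: eq_bigr => j _; rewrite mxE mulr1.
  have : \adj A *m (A *m const_mx 1) = 0 :> 'cV_n.+1 by rewrite A1 mulmx0.
  rewrite mulmxA mul_adj_mx mul_scalar_mx => /colP/(_ 0).
  by rewrite !mxE mulr1.
move=> /existsNP[i row_i]; have [Ai Aii] := inc i.
have [j0 Aj0] : exists j0, forall j, j != j0 -> A i j = 0.
  have [A0|] := pselect (forall j, A i j = 0); first by exists 0.
  move=> /existsNP[j1 Aj1]; exists j1 => j2 j21; apply: contrapT => Aj2.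
  apply: row_i; rewrite (bigD1 j1) //= (bigD1 j2) //= big1 => [|j /andP[jj1 jj2]].
    rewrite addr0; case: (Ai j1) (Aii j2 j1 j21) => [|->|->] //;
      by case: (Ai j2) => [|->|->] // => /(_ erefl).
  case: (Ai j) => // Aj; case: (Ai j1) => // Aj1'; case: (Ai j2) => // Aj2';
    by [apply: (Aii j j1 jj1); rewrite Aj Aj1'|apply: (Aii j j2 jj2); rewrite Aj Aj2'
       |case: Aj2; apply: (Aii j2 j1 j21); rewrite Aj2' Aj1'].
rewrite (expand_det_row A i) (bigD1 j0) //= big1 ?addr0 => [|j jj0]; last first.
  by rewrite Aj0 ?mul0r.
have : signed_incidence (row' i (col' j0 A)).
  move=> i'; have [Ai' Aii'] := inc (lift i i'); split=> [j|j j' jj']; rewrite !mxE //.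
  by apply: Aii'; rewrite (inj_eq lift_inj).
move=> /IH; rewrite /cofactor; set D := \det _.
rewrite -signr_odd; case: (odd _); case: (Ai j0) => ->; case=> ->;
  by [constructor 1|constructor 2|constructor 3].
Qed.

End unimodular.

(** * Changing the constants of the bounded cells *)

Section perturbation.
Variable R : realType.
Implicit Types (x y z : 'rV[R]_2) (m : 'rV[int]_2).

Lemma near0_affine (a b : R) : 0 < a -> \forall s \near (0 : R), 0 < a + s * b.
Proof.
move=> a0; have cf : (fun s : R => a + s * b) @ (0 : R) --> a + 0 * b.
  by apply: (cvgD (cvg_cst _)); apply: cvgM; [exact: cvg_id|exact: cvg_cst].
rewrite mul0r addr0 in cf.
exact: (cf _ (open_nbhs_nbhs (conj (@open_gt R 0) a0))).
Qed.

Variables (Omega : set 'rV[R]_2) (N : nat) (p : 'I_N -> 'rV[R]_2).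
Local Notation F := (relaxation Omega (range p)).
Local Notation Gamma := (corner_locus Omega F).
Variables (B : seq 'rV[int]_2) (c : 'rV[int]_2 -> R).
Hypothesis OP : rational_polygon Omega.
Hypothesis FB : normal_form Omega F B c.
Hypothesis B_irr : forall m, m \in B -> open_cell Omega B c m !=set0.
Local Notation U := (open_cell Omega B c).

Let F_le x m : Omega x -> m \in B -> F x <= aff c m x.
Proof. by case: FB => + _ _ => /[apply] -[_]; apply. Qed.

Let F_ge0 x : Omega x -> 0 <= F x. Proof. by case: FB => _ + _; apply. Qed.

Definition interior_gradient m := closure (U m) `<=` Omega°.

(** At a zero [y] of [aff c m] also [F] is 0, so [y] is in the closed cell and thus interior. A
    nonnegative affine function with an interior zero is identically 0; then [F] is 0 too and has no
    corner [x0]. *)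
Lemma bounded_gt0 x0 m : Gamma x0 -> m \in B -> interior_gradient m ->
  forall y, Omega y -> 0 < aff c m y.
Proof.
move=> x0V mB bm y yO; rewrite lt_def (le_trans (F_ge0 yO)) ?F_le // andbT.
apply/eqP => ly0.
have Fy : F y = aff c m y by apply/eqP; rewrite eq_le F_le //= ly0 F_ge0.
have yO' : Omega° y by apply: bm; rewrite (closure_open_cell OP FB B_irr mB).
have m0 : 0 = m.
  apply: (@aff_touch R y (fun=> 0) c); last by rewrite ly0 /aff dot_lat0 addr0.
  have : nbhs y Omega by exact: yO'.
  apply: filterS => z zO; have := le_trans (F_ge0 zO) (F_le zO mB).
  by rewrite [X in _ -> X <= _]/aff dot_lat0 addr0.
have l0 z : aff c m z = 0.
  by move: ly0; rewrite /aff -m0 !dot_lat0.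
have x0O : nbhs x0 Omega by exact: (x0V.1).
apply: (@corner_locus_nonaffine _ Omega F x0 (c m) m) x0V; move: x0O.
apply: filterS => z zO; apply/eqP; rewrite eq_le [X in X && _]F_le //=.
by have := l0 z; rewrite /aff => ->; exact: F_ge0.
Qed.

Lemma affine_gt0_uniform (A : seq 'rV[int]_2) :
  (forall m, m \in A -> forall y, Omega y -> 0 < aff c m y) ->
  exists2 e : R, 0 < e & forall m, m \in A -> forall y, Omega y -> e <= aff c m y.
Proof.
have [cO [z /interior_subset zO] _] := OP.
elim: A => [_|m A IH A0]; first by exists 1.
have [|e e0 Ae] := IH; first by move=> m' m'A; apply: A0; rewrite inE m'A orbT.
have [||y yO ymin] := @compact_EVT_min _ R (aff c m) Omega _ cO; first by exists z.
  by apply: continuous_subspaceT; exact: aff_continuous.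
exists (Order.min e (aff c m y)).
  by rewrite lt_min e0 A0 ?mem_head //; rewrite inE in yO.
move=> m' /[!inE] /predU1P[->|m'A] x xO; rewrite ge_min.
  by rewrite ymin ?orbT ?inE.
by rewrite Ae.
Qed.

Variables m0 m1 : 'I_N -> 'rV[int]_2.
Hypothesis pO : forall i, Omega° (p i).
Hypothesis m0B : forall i, m0 i \in B.
Hypothesis m1B : forall i, m1 i \in B.
Hypothesis m01 : forall i, m0 i != m1 i.
Hypothesis p_active : forall i m, m \in B ->
  (closure (U m) (p i) <-> m = m0 i \/ m = m1 i).

Let F0 i : F (p i) = aff c (m0 i) (p i).
Proof.
have := (p_active i (m0B i)).2 (or_introl erefl).
by rewrite (closure_open_cell OP FB B_irr (m0B i)) => -[].
Qed.

Let F1 i : F (p i) = aff c (m1 i) (p i).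
Proof.
have := (p_active i (m1B i)).2 (or_intror erefl).
by rewrite (closure_open_cell OP FB B_irr (m1B i)) => -[].
Qed.

(** Only functions with a uniform positive lower bound on [Omega] are altered, so nonnegativity and
    boundary values survive. At [p i] the two active functions move by the same amount and the
    others remain strictly above. *)
Lemma competitor_perturb (d : 'rV[int]_2 -> R) : (0 < N)%N ->
  (forall m, m \in B -> ~ interior_gradient m -> d m = 0) ->
  (forall i, d (m0 i) = d (m1 i)) ->
  \forall s \near (0 : R),
    competitor Omega (range p) (minf B (fun m => c m + s * d m)).
Proof.
move=> N0 d_unb d01; pose i0 := Ordinal N0.
have B0 : B != [::] by have := m0B i0; case: (B).
have i0V : Gamma (p i0).
  apply/(corner_locusP FB); split=> //; by exists (m0 i0), (m1 i0).
pose J := [seq m <- B | `[< interior_gradient m >]].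
have [|e e0 Je] := @affine_gt0_uniform J.
  by move=> m; rewrite mem_filter => /andP[/asboolP bm mB]; exact: bounded_gt0 i0V mB bm.
have near1 : \forall s \near (0 : R), forall m, m \in B -> 0 < e + s * d m.
  apply: (@near_seq _ _ B (nbhs (0 : R)) (fun m s => 0 < e + s * d m)) => m _.
  exact: near0_affine.
have near2 : \forall s \near (0 : R), forall i m, m \in B -> m != m0 i -> m != m1 i ->
    0 < aff c m (p i) - F (p i) + s * (d m - d (m0 i)).
  apply: (@filter_forall _ _ (fun i s => forall m, m \in B -> m != m0 i ->
    m != m1 i -> 0 < aff c m (p i) - F (p i) + s * (d m - d (m0 i))) (nbhs (0 : R))) => i.
  apply: (@near_seq _ _ B (nbhs (0 : R)) (fun m s => m != m0 i -> m != m1 i ->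
    0 < aff c m (p i) - F (p i) + s * (d m - d (m0 i)))) => m mB.
  have [mm0|_] := boolP (m != m0 i); last exact: filterE.
  have [mm1|_] := boolP (m != m1 i); last exact: filterE.
  have piO := interior_subset (pO i).
  have : 0 < aff c m (p i) - F (p i).
    rewrite subr_gt0 lt_def F_le // andbT; apply/eqP => Fm.
    have : closure (U m) (p i) by rewrite (closure_open_cell OP FB B_irr mB).
    by move/(p_active i mB) => [] mE; rewrite mE eqxx in mm0 mm1.
  by move/(@near0_affine _ (d m - d (m0 i))); apply: filterS.
apply: filterS2 near1 near2 => s s1 s2.
set cs := fun m => _.
have csE m x : aff cs m x = aff c m x + s * d m by rewrite /aff /cs addrAC.
have mmin x : is_min_at (minf B cs) B cs x by exact: minfP.
have unb m y : m \in B -> Omega y -> aff c m y = 0 -> d m = 0.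
  move=> mB yO ly; apply: d_unb => // bm.
  by have := bounded_gt0 i0V mB bm yO; rewrite ly ltxx.
have ge0 x : Omega x -> 0 <= minf B cs x.
  move=> xO; have [[m mB ->] _] := mmin x; rewrite csE.
  have [bm|nbm] := pselect (interior_gradient m); last first.
    by rewrite d_unb // mulr0 addr0 (le_trans (F_ge0 xO)) ?F_le.
  have mJ : m \in J by rewrite mem_filter mB andbT; apply/asboolP.
  by have := Je _ mJ _ xO; have := s1 _ mB; lra.
split; first split=> //.
- by apply: continuous_subspaceT; exact: minf_continuous.
- move=> x xB; have xO := xB.1; apply/eqP; rewrite eq_le ge0 // andbT.
  have [Fm _ F_bd] := FB; have [[m mB Fmx] _] := Fm _ xO.
  have lx : aff c m x = 0 by rewrite -Fmx F_bd.
  by apply: le_trans ((mmin x).2 _ mB) _; rewrite csE lx (unb _ _ mB xO lx) mulr0 addr0.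
- by move=> x xO; exists B, cs; exact: filterE.
move=> _ [i _ <-]; split=> //; exists B, cs; split; first exact: filterE.
have lm m : m = m0 i \/ m = m1 i -> minf B cs (p i) = aff cs m (p i).
  move=> mi; have mB : m \in B by case: mi => ->.
  have E : aff cs m (p i) = F (p i) + s * d (m0 i).
    by case: mi => ->; rewrite csE -?F0 -?F1 ?d01.
  apply/eqP; rewrite eq_le (mmin _).2 //= E.
  have [[m' m'B ->] _] := mmin (p i); rewrite csE.
  have [->|mm0] := eqVneq m' (m0 i); first by rewrite -F0.
  have [->|mm1] := eqVneq m' (m1 i); first by rewrite -F1 d01.
  by have := s2 i m' m'B mm0 mm1; rewrite mulrBr; lra.
by exists (m0 i), (m1 i); split=> //; apply: lm; [left|right].
Qed.

(** On the open cell of [m] the relaxation is [aff c m], so its minimality yields [0 <= t * d m] for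
    both [t = s] and [t = - s]. *)
Lemma relaxation_rigid (d : 'rV[int]_2 -> R) : (0 < N)%N ->
  (forall m, m \in B -> ~ interior_gradient m -> d m = 0) ->
  (forall i, d (m0 i) = d (m1 i)) -> forall m, m \in B -> d m = 0.
Proof.
move=> N0 d_unb d01 m mB.
have [s s0 [sp sm]] := near0_pm (competitor_perturb N0 d_unb d01).
have [x xU] := B_irr mB; have xO := interior_subset xU.1.
have Fx := open_cell_eq FB mB xU.
have B0 : B != [::] by case: (B) mB.
have up t : competitor Omega (range p) (minf B (fun m => c m + t * d m)) -> 0 <= t * d m.
  move=> tC; have := le_trans (relaxation_le tC xO) ((minfP _ x B0).2 _ mB).
  by rewrite Fx /aff; lra.
have := up _ sp; have := up _ sm => ? ?; nra.
Qed.

End perturbation.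

(** * Stability of the marked type and the real incidence matrix *)

Section marked_type.
Variable R : realType.
Implicit Types (x y z : 'rV[R]_2) (m : 'rV[int]_2).
Variables (Omega : set 'rV[R]_2) (N : nat) (p : 'I_N -> 'rV[R]_2).
Local Notation F := (relaxation Omega (range p)).
Local Notation Gamma := (corner_locus Omega F).
Variables (B : seq 'rV[int]_2) (c : 'rV[int]_2 -> R).
Hypothesis OP : rational_polygon Omega.
Hypothesis FB : normal_form Omega F B c.
Hypothesis B_irr : forall m, m \in B -> open_cell Omega B c m !=set0.
Local Notation U := (open_cell Omega B c).
Local Notation bd := (interior_gradient Omega B c).
Variables (e : 'I_N -> set 'rV[R]_2) (m0 m1 : 'I_N -> 'rV[int]_2).
Hypothesis N0 : (0 < N)%N.
Hypothesis p_int : forall i, Omega° (p i).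
Hypothesis eE : forall i, edge Omega F (e i).
Hypothesis ep : forall i, relint (e i) (p i).
Hypothesis e_cells : forall i, two_cells Omega B c (m0 i) (m1 i) (e i).

Let m0B i : m0 i \in B. Proof. by case: (e_cells i). Qed.
Let m1B i : m1 i \in B. Proof. by case: (e_cells i). Qed.

(** Corresponding cells have equal gradients, and [d] is the difference of their constants. The
    equation at [i] subtracts the equality of the two adjacent functions at [p i] from the one at
    [q i]. *)
Lemma same_marked_type_shift (q : 'I_N -> 'rV[R]_2) :
  same_marked_type Omega F p (relaxation Omega (range q)) q ->
  exists2 d : 'rV[int]_2 -> R, (forall m, m \in B -> ~ bd m -> d m = 0) &
    forall i, d (m0 i) - d (m1 i) =
      dot (lat R (m1 i) - lat R (m0 i)) (q i - p i).
Proof.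
set F' := relaxation Omega (range q).
move=> [phi [[_ phi_sub phi_kind _] [phi_grad _ _ phi_bd phi_mark]]].
have e_face i : face Omega F (e i) by left; left; right; exact: eE.
have cell_face m : m \in B -> face Omega F (closure (U m)).
  by move=> mB; left; left; left; exact: cell_open_cell.
have e_edge' i : edge Omega F' (phi (e i)).
  by have [_ [+ _] _] := phi_kind _ (e_face i); apply; exact: eE.
have cell' m : m \in B -> cell Omega F' (phi (closure (U m))).
  move=> mB; have [[+ _] _ _] := phi_kind _ (cell_face _ mB); apply.
  exact: cell_open_cell.
(* The image of an edge is an edge, so the new relaxation has a corner. *)
have [B' [c' F'B]] : exists B' c', normal_form Omega F' B' c'.
  apply: relaxation_normal_form => //.
  by have [x [xV _] _] := e_edge' (Ordinal N0); exists x.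
have /choice[c1 c1E] : forall m, exists c1 : R, m \in B ->
    forall x, phi (closure (U m)) x -> F' x = c1 + dot (lat R m) x.
  move=> m; have [mB|_] := boolP (m \in B); last by exists 0.
  have [grad _] := phi_grad _ m (cell_open_cell OP FB B_irr mB).
  have [|c1 c1E] := grad; last by exists c1.
  by exists (c m) => x; rewrite (closure_open_cell OP FB B_irr mB) => -[].
exists (fun m => c1 m - c m) => [m mB ubd|i].
  have [x [xU xO]] : exists x, closure (U m) x /\ ~ Omega° x.
    by apply: contrapT => h; apply: ubd => x xU; apply: contrapT => xO; apply: h; exists x.
  have [xO' Fx] : Omega x /\ F x = aff c m x.
    by move: xU; rewrite (closure_open_cell OP FB B_irr mB).
  have xB : (Omega `\` Omega°) x by [].
  have [S SP Sx] := boundary_polygon_face OP xB.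
  have [meet _] := phi_bd _ _ SP (cell_face _ mB).
  have [|y [yU Sy]] := meet; first by exists x.
  have yB := polygon_face_boundary SP Sy.1.
  have [Fmin F_ge0 F_bd] := FB; have [_ F'_ge0 F'_bd] := F'B.
  have F'y := c1E _ mB _ yU.
  have maj : F' x <= c1 m + dot (lat R m) x.
    by apply: (cell_majorant F'B (cell' _ mB)) => //; [exists y|exact: c1E].
  (* The boundary points [x] of the cell and [y] of its image may differ. Domination gives
     [c m <= c1 m] at [x] and [c1 m <= c m] at [y], as both relaxations vanish at both points. *)
  have := (Fmin _ yB.1).2 _ mB; have := F_ge0 _ yB.1; have := F'_ge0 _ xO'.
  move: Fx F'y maj; rewrite !F_bd // !F'_bd // /aff; lra.
have [_ _ _ /(_ _ (ep i).1)[p0 p1]] := e_cells i.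
have [Fp0 Fp1] : F (p i) = aff c (m0 i) (p i) /\ F (p i) = aff c (m1 i) (p i).
  by move: p0 p1; rewrite !(closure_open_cell OP FB B_irr) // => -[_ ?] [_ ?].
have qe : phi (e i) (q i) by have [/(_ (ep i))[]] := phi_mark i _ (e_face i).
have q0 : phi (closure (U (m0 i))) (q i).
  have [h _] := phi_sub _ _ (e_face i) (cell_face _ (m0B i)); apply: h qe.
  by case: (e_cells i) => _ _ _ h x /h[].
have q1 : phi (closure (U (m1 i))) (q i).
  have [h _] := phi_sub _ _ (e_face i) (cell_face _ (m1B i)); apply: h qe.
  by case: (e_cells i) => _ _ _ h x /h[].
have := c1E _ (m0B i) _ q0; rewrite (c1E _ (m1B i) _ q1) => Fq.
by move: Fp0 Fp1; rewrite /aff !dotR => -> ?; lra.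
Qed.

Variables (n : nat) (sg : 'I_n -> 'rV[int]_2).
Hypothesis sg_inj : injective sg.
Hypothesis sgP : forall m, (m \in B /\ bd m) <-> exists j, sg j = m.

(** The ring varies: kernels are computed over [R], the determinant over [int], and over ['F_2] the
    signs disappear. *)
Definition incidence (T : pzRingType) : 'M[T]_(N, n) :=
  \matrix_(i, j) ((sg j == m0 i)%:R - (sg j == m1 i)%:R).

Lemma sum_indicator (d : 'rV[int]_2 -> R) m : m \in B ->
  (forall m, m \in B -> ~ bd m -> d m = 0) ->
  \sum_j (sg j == m)%:R * d (sg j) = d m.
Proof.
move=> mB d_unb; have [bm|nbm] := pselect (bd m).
  have [j jm] := (sgP m).1 (conj mB bm).
  rewrite (bigD1 j) //= jm eqxx mul1r big1 ?addr0 // => k kj.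
  by rewrite -jm (inj_eq sg_inj) (negPf kj) mul0r.
rewrite d_unb // big1 // => j _; have [jm|] := eqVneq; last by rewrite mul0r.
by case: nbm; have [|] := (sgP m).2 _; first by exists j.
Qed.

Lemma incidence_mul (d : 'rV[int]_2 -> R) :
  (forall m, m \in B -> ~ bd m -> d m = 0) ->
  incidence R *m (\col_j d (sg j)) = \col_i (d (m0 i) - d (m1 i)).
Proof.
move=> d_unb; apply/colP => i; rewrite !mxE -(sum_indicator (m0B i)) //.
rewrite -[X in _ - X](sum_indicator (m1B i)) // -sumrB; apply: eq_bigr => j _.
by rewrite !mxE mulrBl.
Qed.

(** For [u] in the left kernel, move each [p i] by a small multiple [s] of [u 0 i] times
    [m1 i - m0 i]. Pairing [u] with the resulting shift equation makes the sum of the terms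
    [s * u 0 i ^+ 2 * |m1 i - m0 i|^2] vanish. *)
Lemma incidence_row_free :
  (exists2 eps : R, 0 < eps &
     forall q : 'I_N -> 'rV[R]_2, (forall i, ball (p i) eps (q i)) ->
       same_marked_type Omega F p (relaxation Omega (range q)) q) ->
  row_free (incidence R).
Proof.
move=> [eps eps0 stable]; apply: inj_row_free => u u0.
pose v i := u 0 i *: (lat R (m1 i) - lat R (m0 i)).
have [s s0 [near_p _]] : exists2 s : R, 0 < s &
    (forall i, ball (p i) eps (p i + s *: v i)) /\
    (forall i, ball (p i) eps (p i + - s *: v i)).
  apply: near0_pm.
  apply: (@filter_forall _ _ (fun i s => ball (p i) eps (p i + s *: v i)) (nbhs (0 : R))) => i.
  by apply: nbhs_line; exact: nbhsx_ballx.
have [d d_unb dE] := same_marked_type_shift (stable _ near_p).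
have := congr1 (mulmx u) (incidence_mul d_unb).
rewrite mulmxA u0 mul0mx => /matrixP/(_ 0 0); rewrite !mxE => /esym.
pose w i := lat R (m1 i) - lat R (m0 i).
rewrite (eq_bigr (fun i => s * u 0 i ^+ 2 * dot (w i) (w i))) => [|i _]; last first.
  by rewrite mxE dE (addrC (p i)) addrK !dotZr -/(w i); ring.
move=> /eqP; rewrite psumr_eq0 => [/allP u_eq0|i _]; last first.
  by rewrite mulr_ge0 ?dot_ge0 // mulr_ge0 ?sqr_ge0 ?ltW.
apply/rowP => i; rewrite mxE.
have := u_eq0 i (mem_index_enum i); rewrite !mulf_eq0 /= (gt_eqF s0).
rewrite dot_eq0 /w subr_eq0 (inj_eq (@lat_inj R)).
have [_ _ /negPf m01 _] := e_cells i.
by rewrite (eq_sym (m1 i)) m01 !orbF ?orbb => /eqP.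
Qed.

(** A vector of the right kernel, extended by 0 to the other gradients, is a perturbation to which
    rigidity applies. *)
Lemma incidence_tr_row_free : row_free (incidence R)^T.
Proof.
apply: inj_row_free => u u0.
have M0 : incidence R *m u^T = 0 by rewrite -[_ *m _]trmxK trmx_mul trmxK u0 trmx0.
pose d m := \sum_j (sg j == m)%:R * u 0 j.
have d_sg j : d (sg j) = u 0 j.
  rewrite /d (bigD1 j) //= eqxx mul1r big1 ?addr0 // => k kj.
  by rewrite (inj_eq sg_inj) (negPf kj) mul0r.
have d_unb m : m \in B -> ~ bd m -> d m = 0.
  move=> mB nbm; rewrite /d big1 // => j _; have [jm|] := eqVneq; last by rewrite mul0r.
  by case: nbm; have [|] := (sgP m).2 _; first by exists j.
have d01 i : d (m0 i) = d (m1 i).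
  apply/eqP; rewrite -subr_eq0; apply/eqP.
  have := incidence_mul d_unb => /colP/(_ i); rewrite [X in _ = X]mxE => <-.
  rewrite (_ : \col_j d (sg j) = u^T) ?M0 ?mxE //.
  by apply/colP => j; rewrite !mxE d_sg.
apply/rowP => j; rewrite mxE -d_sg.
have [sB _] := (sgP (sg j)).2 (ex_intro _ j erefl).
have m01 i : m0 i != m1 i by case: (e_cells i).
apply: (relaxation_rigid OP FB B_irr p_int m0B m1B m01 _ N0 d_unb d01 sB).
by move=> i m mB; exact: (relint_edge_active OP FB B_irr _ (eE i) (ep i)).
Qed.

End marked_type.

(** * Reduction modulo 2 and the final count *)

Lemma row_free_tr_square (K : fieldType) m n (A : 'M[K]_(m, n)) :
  row_free A -> row_free A^T -> m = n.
Proof. by rewrite /row_free mxrank_tr => /eqP rm /eqP rn; rewrite -rm -{2}rn. Qed.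

Lemma incidence_signed N (sg m0 m1 : 'I_N -> 'rV[int]_2) :
  injective sg -> (forall i, m0 i != m1 i) ->
  signed_incidence (incidence m0 m1 sg int).
Proof.
move=> sg_inj m01 i; split=> [j|j j' jj']; rewrite !mxE.
  have [->|_] := eqVneq (sg j) (m0 i).
    by rewrite (negPf (m01 i)) subr0; constructor 2.
  by have [_|_] := eqVneq (sg j) (m1 i); [constructor 3|constructor 1].
have uniq m : sg j = m -> sg j' = m -> False.
  by move=> jm j'm; move: jj'; rewrite -(inj_eq sg_inj) jm j'm eqxx.
have [j0|_] := eqVneq (sg j) (m0 i); have [j1|_] := eqVneq (sg j) (m1 i);
  have [k0|_] := eqVneq (sg j') (m0 i); have [k1|_] := eqVneq (sg j') (m1 i) => //;
  by [case: (uniq _ j0)|case: (uniq _ j1)|move: (m01 i); rewrite -j0 -j1 eqxx].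
Qed.

(** Both determinants are images of one integer among 0, 1 and -1; being nonzero in [R], it is a
    unit in every ring. *)
Lemma incidence_F2_unit (R : realType) N (sg m0 m1 : 'I_N -> 'rV[int]_2) :
  injective sg -> (forall i, m0 i != m1 i) ->
  row_free (incidence m0 m1 sg R) -> incidence m0 m1 sg 'F_2 \in unitmx.
Proof.
move=> sg_inj m01; rewrite row_free_unit.
have map_inc (T : comNzRingType) : incidence m0 m1 sg T = map_mx intr (incidence m0 m1 sg int).
  by apply/matrixP => i j; rewrite !mxE rmorphB /= !rmorph_nat.
rewrite (map_inc R) (map_inc 'F_2) !unitmxE !det_map_mx.
have [->|->|->] := det_signed_incidence (incidence_signed sg_inj m01).
- by rewrite rmorph0 unitr0.
- by rewrite rmorph1 unitr1.
- by rewrite rmorphN1 unitrN1.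
Qed.

Theorem theorem4p20 (R : realType) (Omega : set 'rV[R]_2) (N : nat)
    (P : 'I_N -> 'rV[R]_2) :
  rational_polygon Omega -> (0 < N)%N -> strongly_generic Omega P ->
  let Gamma := corner_locus Omega (relaxation Omega (range P)) in
  bounded_cell Omega Gamma #= `I_N /\
  (forall C : 'I_N -> set 'rV[R]_2,
     set_bij [set: 'I_N] (bounded_cell Omega Gamma) C ->
     basis_of {: 'rV['F_2]_N} [tuple incidence_vector P C i | i < N]).
Proof.
move=> OP N0 [[P_inj P_int] P_edge _ stable] Gamma.
set F := relaxation Omega (range P) in P_edge stable Gamma *.
have /choice[e eP] : forall i, exists e, edge Omega F e /\ relint e (P i).
  by move=> i; have [e ? ?] := P_edge i; exists e.
have eE i := (eP i).1; have ep i := (eP i).2.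
have V0 : Gamma !=set0 by have [x [xV _] _] := eE (Ordinal N0); exists x.
have [B0 [c FB0]] := relaxation_normal_form OP V0.
have [B FB B_irr] := irredundant_normal_form OP FB0.
have /choice[m0 /choice[m1 e_cells]] : forall i, exists m0, exists m1,
    two_cells Omega B c m0 m1 (e i).
  by move=> i; exact: (edge_two_cells OP FB B_irr (eE i)).
have m01 i : m0 i != m1 i by case: (e_cells i).
(* The enumeration of bounded cells is left arbitrary: the count uses a list of their gradients, the
   basis uses the labelling given by [C]. *)
have free n (sg : 'I_n -> _) (sg_inj : injective sg) sgP :=
  conj (incidence_row_free OP FB B_irr N0 eE ep e_cells sg_inj sgP stable)
       (incidence_tr_row_free OP FB B_irr N0 P_int eE ep e_cells sg_inj sgP).
have cellsE := bounded_cellE OP FB B_irr.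
split.
  pose J := undup [seq m <- B | `[< interior_gradient Omega B c m >]].
  pose sg (j : 'I_(size J)) := nth 0 J j.
  have sg_inj : injective sg.
    move=> j k /eqP; rewrite nth_uniq ?undup_uniq // => /eqP; exact: val_inj.
  have sgP m : (m \in B /\ interior_gradient Omega B c m) <-> exists j, sg j = m.
    split=> [[mB bm]|[j <-]].
      have mJ : m \in J by rewrite mem_undup mem_filter mB andbT; apply/asboolP.
      have jlt : (index m J < size J)%N by rewrite index_mem.
      by exists (Ordinal jlt); rewrite /sg /= nth_index.
    have : sg j \in J by exact: mem_nth.
    by rewrite mem_undup mem_filter => /andP[/asboolP].
  have [M_free Mt_free] := free _ sg sg_inj sgP.
  rewrite (row_free_tr_square M_free Mt_free) cellsE.
  rewrite (_ : [set _ | _ in _] = [set open_cell Omega B c (sg j) | j in [set: 'I_(size J)]]).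
    apply: (card_eq_trans (inj_card_eq _)); last by rewrite card_eq_sym card_II.
    move=> j k _ _ /(open_cell_inj FB B_irr) jk; apply/sg_inj/jk.
      by have [] := (sgP (sg j)).2 (ex_intro _ j erefl).
    by have [] := (sgP (sg k)).2 (ex_intro _ k erefl).
  apply/seteqP; split=> [_ [m /sgP[j <-] <-]|_ [j _ <-]]; first by exists j.
  by exists (sg j) => //; apply/sgP; exists j.
move=> C [C_fun C_inj C_surj].
have /choice[sg sgE] : forall j, exists m,
    (m \in B /\ interior_gradient Omega B c m) /\ open_cell Omega B c m = C j.
  by move=> j; have := C_fun j I; rewrite cellsE => -[m mB <-]; exists m.
have sgB j : sg j \in B by case: (sgE j) => -[].
have sg_inj : injective sg.
  move=> j k jk; apply: C_inj; rewrite ?inE //.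
  by rewrite -(sgE j).2 -(sgE k).2 jk.
have sgP m : (m \in B /\ interior_gradient Omega B c m) <-> exists j, sg j = m.
  split=> [[mB bm]|[j <-]]; last exact: (sgE j).1.
  have [|j _ jm] := C_surj (open_cell Omega B c m); first by rewrite cellsE; exists m.
  by exists j; apply: (open_cell_inj FB B_irr (sgB j) mB); rewrite (sgE j).2.
have [M_free _] := free _ sg sg_inj sgP.
have M_unit := incidence_F2_unit sg_inj m01 M_free.
have rowE i : incidence_vector P C i = row i (incidence m0 m1 sg 'F_2).
  apply/rowP => j; rewrite !mxE -(sgE j).2.
  have act := relint_edge_active OP FB B_irr (P_int i) (eE i) (ep i) (e_cells i) (sgB j).
  have [j0|j0] := eqVneq (sg j) (m0 i).
    have -> : P i \in closure (open_cell Omega B c (sg j)) by rewrite inE; apply/act; left.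
    by rewrite j0 (negPf (m01 i)) subr0.
  have [j1|j1] := eqVneq (sg j) (m1 i).
    have -> : P i \in closure (open_cell Omega B c (sg j)) by rewrite inE; apply/act; right.
    (* Here [0 - 1 = 1] in ['F_2]. *)
    by apply: val_inj.
  have /negPf -> : P i \notin closure (open_cell Omega B c (sg j)).
    by apply/negP; rewrite inE => /act[]; apply/eqP.
  by rewrite subrr.
rewrite basisEfree subvf /=; apply/andP; split; last first.
  by rewrite dimvf size_tuple card_ord dim_matrix; apply: eq_leq; exact: mul1n.
apply/freeP => k k0 i.
(* The coefficients [k] are indexed by positions in the enumeration of ['I_N], hence the
   reindexing. *)
pose u := \row_(j < N) k (enum_rank j).
have u0 : u *m incidence m0 m1 sg 'F_2 = 0.
  rewrite mulmx_sum_row -[RHS]k0 (reindex _ (onW_bij _ (enum_rank_bij _))) /=.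
  apply: eq_bigr => j _; rewrite mxE -rowE (nth_map j) ?nth_enum_rank //.
  by rewrite -cardE.
have : u = 0 by rewrite -(mulmxK M_unit u) u0 mul0mx.
by move=> /rowP/(_ (enum_val i)); rewrite !mxE enum_valK.
Qed.
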